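(* In the setting and notation described in the context, assume $\mathcal K=\mathbb R^n$, the oracle is noiseless ($\mathcal O(x)=\nabla f(x)$ with probability 1), and $r_\epsilon\le d_0$. Run the UDoG template with the step sizes \[ \eta_{x,t}=\frac{\bar r_t}{12\log_+^2\!\left(\frac{\|m_0\|^2+Q_{t-1}}{\|m_0\|^2}\right)\sqrt{\max\{\|m_0\|^2+Q_{t-1},M_t\}}},\qquad \eta_{y,t}=\frac{\bar r_t}{12\log_+^2\!\left(\frac{\|m_0\|^2+Q_{t}}{\|m_0\|^2}\right)\sqrt{\max\{\|m_0\|^2+Q_{t},M_t\}}}. \] Then $\bar d_T\le 2d_0$, $\bar r_T\le 4d_0$, and for $\tau=\arg\max_{t<T}\sum_{i\le t}\frac{\bar r_i}{\bar r_{t+1}}$, \[ f(\bar x_\tau)-f(x^\star)\le O\!\left(c_{r_\epsilon,T}\min\left\{\frac{\beta d_0^2}{T^2},\frac{Gd_0}{\sqrt T}\right\}\right), \] where $c_{r_\epsilon,T}=\log_+^4\!\left(1+\frac{T\min\{\beta d_0^2,Gd_0\}}{f(x_0)-f(x^\star)}\right)\log_+^2\!\left(\frac{d_0}{r_\epsilon}\right)$ and $O(\cdot)$ hides an absolute constant.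
   Context: Norms are Euclidean, $\log_+(x)=1+\log x$. Standing assumptions: $f:\mathbb R^n\to\mathbb R$ convex, $G$-Lipschitz and $\beta$-smooth ($G$ or $\beta$ may be $+\infty$), with a minimizer $x^\star$; gradient oracle $\mathcal O$. UDoG template: given $x_0$, $T$, $r_\epsilon>0$, set $y_0=x_0$ and for $t=0,\dots,T-1$: $\bar r_t=\max_{k\le t}\max\{\|y_k-x_0\|,\|x_k-x_0\|,r_\epsilon\}$, $\alpha_t=\sum_{k=0}^t\bar r_k/\bar r_t$, $w_t=\alpha_t\bar r_t$; $\bar z_t=\frac{w_ty_t+\sum_{k=0}^{t-1}w_kx_{k+1}}{\sum_{k=0}^tw_k}$, $m_t\sim\mathcal O(\bar z_t)$, $x_{t+1}=y_t-\alpha_t\eta_{x,t}m_t$; $\bar x_t=\frac{\sum_{k=0}^tw_kx_{k+1}}{\sum_{k=0}^tw_k}$, $g_t\sim\mathcal O(\bar x_t)$, $y_{t+1}=y_t-\alpha_t\eta_{y,t}g_t$. Notation: $q_t=\alpha_t^2\|g_t-m_t\|^2$, $Q_t=\sum_{k=0}^tq_k$, $Q_{-1}=0$, $M_t=\max_{k\le t}\alpha_k^2\|m_k\|^2$, $d_t=\|y_t-x^\star\|$, $\bar d_t=\max_{k\le t}d_k$. *)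

(* Defs.v *)
From HB Require Import structures.
From mathcomp Require Import all_boot all_order all_algebra.
From mathcomp Require Import all_classical all_reals all_analysis.
Set Implicit Arguments. Unset Strict Implicit. Unset Printing Implicit Defensive.
Import Order.TTheory GRing.Theory Num.Theory.
Local Open Scope ring_scope.

Section UDoG.
Variables (R : realType) (n : nat).
Notation vec := 'rV[R]_n.

Definition dotv (u v : vec) : R := \sum_(i < n) u ord0 i * v ord0 i.
Definition enorm (u : vec) : R := Num.sqrt (dotv u u).

Definition logp (x : R) : R := 1 + ln x.

Definition convex_fun (f : vec -> R) : Prop :=
  forall (u v : vec) (l : R), 0 <= l -> l <= 1 ->
    f (l *: u + (1 - l) *: v) <= l * f u + (1 - l) * f v.
Definition lipschitz_fun (G : R) (f : vec -> R) : Prop :=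
  forall u v : vec, `|f u - f v| <= G * enorm (u - v).
Definition is_subgrad_oracle (f : vec -> R) (grad : vec -> vec) : Prop :=
  forall u v : vec, f u + dotv (grad u) (v - u) <= f v.
Definition smooth_fun (beta : R) (grad : vec -> vec) : Prop :=
  forall u v : vec, enorm (grad u - grad v) <= beta * enorm (u - v).

Variables (grad : vec -> vec) (reps : R) (x y : nat -> vec).

Definition rbar (t : nat) : R :=
  \big[Num.max/reps]_(k < t.+1) Num.max (enorm (y k - x 0%N)) (enorm (x k - x 0%N)).
Definition alpha (t : nat) : R := (\sum_(k < t.+1) rbar k) / rbar t.
Definition wgt (t : nat) : R := alpha t * rbar t.
Definition zbar (t : nat) : vec :=
  (\sum_(k < t.+1) wgt k)^-1 *: (wgt t *: y t + \sum_(k < t) wgt k *: x k.+1).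
Definition xbar (t : nat) : vec :=
  (\sum_(k < t.+1) wgt k)^-1 *: (\sum_(k < t.+1) wgt k *: x k.+1).
Definition mm (t : nat) : vec := grad (zbar t).
Definition gg (t : nat) : vec := grad (xbar t).
Definition qq (t : nat) : R := alpha t ^+ 2 * enorm (gg t - mm t) ^+ 2.
(** Qprev t = Q_{t-1} = sum_{k < t} q_k  (so Q_{-1} = 0 and Q_t = Qprev t.+1). *)
Definition Qprev (t : nat) : R := \sum_(k < t) qq k.
Definition MM (t : nat) : R := \big[Num.max/0]_(k < t.+1) (alpha k ^+ 2 * enorm (mm k) ^+ 2).

Definition eta_x (t : nat) : R :=
  rbar t / (12 * logp ((enorm (mm 0%N) ^+ 2 + Qprev t) / enorm (mm 0%N) ^+ 2) ^+ 2
              * Num.sqrt (Num.max (enorm (mm 0%N) ^+ 2 + Qprev t) (MM t))).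
Definition eta_y (t : nat) : R :=
  rbar t / (12 * logp ((enorm (mm 0%N) ^+ 2 + Qprev t.+1) / enorm (mm 0%N) ^+ 2) ^+ 2
              * Num.sqrt (Num.max (enorm (mm 0%N) ^+ 2 + Qprev t.+1) (MM t))).

Definition udog_run (T : nat) : Prop :=
  y 0%N = x 0%N /\
  forall t : nat, (t < T)%N ->
    x t.+1 = y t - (alpha t * eta_x t) *: mm t /\
    y t.+1 = y t - (alpha t * eta_y t) *: gg t.

Definition dbar (xstar : vec) (t : nat) : R :=
  \big[Num.max/0]_(k < t.+1) enorm (y k - xstar).

Definition tau_ratio (t : nat) : R := (\sum_(i < t.+1) rbar i) / rbar t.+1.
End UDoG.

(** Extended-real bookkeeping for G, beta possibly = +oo (None). *)
Definition omin (R : realType) (a b : option R) : option R :=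
  match a, b with
  | Some u, Some v => Some (Num.min u v)
  | Some u, None => Some u
  | None, Some v => Some v
  | None, None => None
  end.

(* Main.v *)
Require Import Defs.
From HB Require Import structures.
From mathcomp Require Import all_boot all_order all_algebra.
From mathcomp Require Import all_classical all_reals all_analysis.
From mathcomp Require Import ring lra.
Import Order.TTheory GRing.Theory Num.Theory.
Set Implicit Arguments. Unset Strict Implicit. Unset Printing Implicit Defensive.
Local Open Scope ring_scope.

(* Let w_t = r_0 + ... + r_t, S_t = w_0 + ... + w_t and D_t = r_t / eta_{y,t}. Averaging gives
   S_t (f(xbar_t) - f(xstar)) <= sum_k w_k <g_k, x_{k+1} - xstar>, and each summand is at most
   D_k (d_k^2 - d_{k+1}^2) / 2 + e_k - ||y_k - x_{k+1}||^2 r_k / (2 eta_{x,k}), where e_k / D_k is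
   r_k^2 times the increment of the potential -1/log_+, up to a constant.
   Dividing by the nondecreasing D_k telescopes the distances and yields the stability bounds;
   without dividing, summation by parts bounds the regret by 5 D_t r_{t+1} d_0 minus the negative
   terms. In the Lipschitz case D_t is bounded directly. In the smooth case q_k is at most
   4 beta^2 ||y_k - x_{k+1}||^2, so the negative terms absorb Q_t, while M_t is controlled through
   ||grad f||^2 <= 4 beta (f - f(xstar)) and the regret bound itself.
   Finally w_t^2 <= 2 r_t S_t, and the best ratio w_t / r_{t+1} is of order T / log_+(d_0 / r_eps),
   since r grows geometrically as long as the ratio is small. *)

(** * Euclidean inner product and norm on row vectors *)

Section Euclidean.
Variables (R : realType) (n : nat).
Implicit Types (u v z : 'rV[R]_n) (c : R).

Lemma dotvC u v : dotv u v = dotv v u.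
Proof. by apply: eq_bigr => i _; rewrite mulrC. Qed.

Lemma dotvDl u v z : dotv (u + v) z = dotv u z + dotv v z.
Proof. by rewrite -big_split; apply: eq_bigr => i _; rewrite mxE mulrDl. Qed.

Lemma dotvZl c u v : dotv (c *: u) v = c * dotv u v.
Proof. by rewrite mulr_sumr; apply: eq_bigr => i _; rewrite mxE mulrA. Qed.

Lemma dotvNl u v : dotv (- u) v = - dotv u v.
Proof. by rewrite -scaleN1r dotvZl mulN1r. Qed.

Lemma dotvBl u v z : dotv (u - v) z = dotv u z - dotv v z.
Proof. by rewrite dotvDl dotvNl. Qed.

Lemma dotvDr u v z : dotv u (v + z) = dotv u v + dotv u z.
Proof. by rewrite dotvC dotvDl !(dotvC u). Qed.

Lemma dotvZr c u v : dotv u (c *: v) = c * dotv u v.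
Proof. by rewrite dotvC dotvZl (dotvC u). Qed.

Lemma dotvNr u v : dotv u (- v) = - dotv u v.
Proof. by rewrite dotvC dotvNl (dotvC u). Qed.

Lemma dotvBr u v z : dotv u (v - z) = dotv u v - dotv u z.
Proof. by rewrite dotvDr dotvNr. Qed.

Lemma dotv0r u : dotv u 0 = 0.
Proof. by rewrite -(scale0r 0) dotvZr mul0r. Qed.

Definition dotvE := (dotvDl, dotvDr, dotvNl, dotvNr, dotvZl, dotvZr).

Lemma dotvv_ge0 u : 0 <= dotv u u.
Proof. by apply: sumr_ge0 => i _; rewrite -expr2 sqr_ge0. Qed.

Lemma dotvv_eq0 u : (dotv u u == 0) = (u == 0).
Proof.
apply/eqP/eqP => [u0|->]; last by rewrite dotv0r.
apply/rowP => i; rewrite mxE; apply/eqP; rewrite -sqrf_eq0 expr2.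
apply/eqP; have /psumr_eq0P := u0; apply=> // j _.
by rewrite -expr2 sqr_ge0.
Qed.

Lemma enorm_ge0 u : 0 <= enorm u.
Proof. exact: sqrtr_ge0. Qed.
Hint Resolve enorm_ge0 : core.

Lemma enorm_sqr u : enorm u ^+ 2 = dotv u u.
Proof. by rewrite sqr_sqrtr ?dotvv_ge0. Qed.

Lemma enorm0 : enorm (0 : 'rV[R]_n) = 0.
Proof. by rewrite /enorm dotv0r sqrtr0. Qed.

Lemma enorm_gt0 u : (0 < enorm u) = (u != 0).
Proof. by rewrite sqrtr_gt0 lt0r dotvv_ge0 andbT dotvv_eq0. Qed.

Lemma enormZ c u : enorm (c *: u) = `|c| * enorm u.
Proof.
by rewrite /enorm dotvZl dotvZr mulrA -expr2 sqrtrM ?sqr_ge0 // sqrtr_sqr.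
Qed.

Lemma enormN u : enorm (- u) = enorm u.
Proof. by rewrite -scaleN1r enormZ normrN1 mul1r. Qed.

Lemma enormBC u v : enorm (u - v) = enorm (v - u).
Proof. by rewrite -opprB enormN. Qed.

Lemma dotv_le u v : dotv u v <= enorm u * enorm v.
Proof.
have [->|v0] := eqVneq v 0; first by rewrite dotv0r enorm0 mulr0.
have vp : 0 < enorm v by rewrite enorm_gt0.
(* Expanding this square gives Cauchy-Schwarz multiplied by [2 * ||u|| * ||v||], which is cancelled
   below. *)
have := dotvv_ge0 (enorm v *: u - enorm u *: v).
rewrite !dotvE (dotvC v u) -!enorm_sqr => h.
have [->|u0] := eqVneq u 0.
  by rewrite dotvC dotv0r enorm0 mul0r.
have up : 0 < enorm u by rewrite enorm_gt0.
have uvp : 0 < enorm u * enorm v by rewrite mulr_gt0.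
rewrite -(ler_pM2l uvp); nra.
Qed.

Lemma dotv_ge u v : - (enorm u * enorm v) <= dotv u v.
Proof. by rewrite lerNl -dotvNl -(enormN u) dotv_le. Qed.

Lemma enormD u v : enorm (u + v) <= enorm u + enorm v.
Proof.
rewrite -(ler_pXn2r (n := 2)) ?nnegrE ?addr_ge0 //.
rewrite enorm_sqr !dotvE (dotvC v u) sqrrD !enorm_sqr.
by have := dotv_le u v; lra.
Qed.

Lemma enormB_le u v z : enorm (u - z) <= enorm (u - v) + enorm (v - z).
Proof. by rewrite -[u - z](subrKA v) enormD. Qed.

Lemma enormB u v : enorm (u - v) <= enorm u + enorm v.
Proof. by rewrite -(enormN v) enormD. Qed.

End Euclidean.

(** * Real sequences: summation by parts and growth of partial sums *)

Section Sequences.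
Variable R : realType.
Implicit Types (r w a p D : nat -> R).

Lemma logp_ge1 (a : R) : 1 <= a -> 1 <= logp a.
Proof. by move=> a1; rewrite /logp lerDl ln_ge0. Qed.

Lemma ler_logp (a b : R) : 0 < a -> a <= b -> logp a <= logp b.
Proof. by move=> a0 ab; rewrite lerD2l ler_ln ?posrE // (lt_le_trans a0). Qed.

Lemma ln_ge_sub_inv (a : R) : 0 < a -> 1 - a^-1 <= ln a.
Proof.
move=> a0; have := le_ln1Dx (x := a^-1 - 1).
rewrite subrKC lnV ?posrE //.
by rewrite ltrBrDl subrr invr_gt0 => /(_ a0); lra.
Qed.

Lemma sqr_le (a b : R) : 0 <= a -> a <= b -> a ^+ 2 <= b ^+ 2.
Proof. by move=> a0 ab; rewrite lerXn2r // nnegrE // (le_trans a0). Qed.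

Lemma telescope_sum_ord (u : nat -> R) (t : nat) :
  \sum_(k < t) (u k - u k.+1) = u 0%N - u t.
Proof.
elim: t => [|t IH]; first by rewrite big_ord0 subrr.
by rewrite big_ord_recr /= IH subrKA.
Qed.

(** Abel summation with the nonincreasing weights [1 / D]: by induction the whole sum is at least
    the last partial sum of [p] divided by [D t]. *)
Lemma sum_scaled_ge0 p D (t : nat) :
  (forall k, (k <= t)%N -> 0 < D k) ->
  (forall k, (k < t)%N -> D k <= D k.+1) ->
  (forall k, (k <= t)%N -> 0 <= \sum_(i < k.+1) p i) ->
  0 <= \sum_(i < t.+1) p i / D i.
Proof.
move=> D0 Dm P0.
suff : (\sum_(i < t.+1) p i) / D t <= \sum_(i < t.+1) p i / D i.
  by apply: le_trans; rewrite divr_ge0 ?P0 // ltW ?D0.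
elim: t D0 Dm P0 => [|t IH] D0 Dm P0; first by rewrite !big_ord1.
rewrite big_ord_recr [leRHS]big_ord_recr /= mulrDl lerD2r.
have h := IH (fun k kt => D0 k (leqW kt)) (fun k kt => Dm k (leqW kt))
             (fun k kt => P0 k (leqW kt)).
apply: le_trans h; apply: ler_wpM2l; first exact: P0.
by rewrite lef_pV2 ?posrE ?D0 // Dm.
Qed.

(** Summation by parts: passing from [D t] to [D t.+1] raises the bound by
    [(D t.+1 - D t) * (B - a t.+1)], which is nonnegative. *)
Lemma sum_mul_diff_le D a (t : nat) (B : R) :
  0 <= D 0%N ->
  (forall k, (k < t)%N -> D k <= D k.+1) ->
  (forall k, (k <= t)%N -> a k <= B) ->
  \sum_(k < t.+1) D k * (a k - a k.+1) <= D t * (B - a t.+1).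
Proof.
move=> D0; elim: t => [|t IH] Dm aB.
  by rewrite big_ord1 ler_wpM2l // lerB // aB.
rewrite big_ord_recr /=.
have h := IH (fun k kt => Dm k (leqW kt)) (fun k kt => aB k (leqW kt)).
apply: le_trans (lerD h (lexx _)) _.
have := Dm t (ltnSn t); have := aB t.+1 (leqnn _).
nra.
Qed.

(** Induction on [t]: the square grows by [2 w_t r_{t+1} + r_{t+1}^2], the right side by at least [2
    r_{t+1} w_{t+1} = 2 w_t r_{t+1} + 2 r_{t+1}^2]. *)
Lemma sqr_sum_le r w (t : nat) :
  (forall k, 0 <= r k) -> (forall k, r k <= r k.+1) ->
  (forall k, w k = \sum_(i < k.+1) r i) ->
  w t ^+ 2 <= 2 * r t * \sum_(k < t.+1) w k.
Proof.
move=> r0 rm wE.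
have w0 k : 0 <= w k by rewrite wE sumr_ge0.
elim: t => [|t IH].
  by rewrite big_ord1 wE big_ord1; have := r0 0%N; nra.
rewrite big_ord_recr /=.
have wS : w t.+1 = w t + r t.+1 by rewrite !wE big_ord_recr.
have S0 : 0 <= \sum_(k < t.+1) w k by rewrite sumr_ge0.
move: IH S0; set S := \sum_(k < _) _ => IH S0.
have := rm t; have := r0 t; have := r0 t.+1; have := w0 t; rewrite wS.
nra.
Qed.

(* While [w k <= rho * r 0] the index is at most [rho]; afterwards each step multiplies [w] by at
   least [1 + 1/rho]. *)
Lemma index_le_ratio_log r w (rho : R) (T : nat) :
  0 < r 0%N -> 0 < rho -> (forall k, r k <= r k.+1) ->
  (forall k, w k = \sum_(i < k.+1) r i) ->
  (forall k, (k < T)%N -> w k <= rho * r k.+1) ->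
  T%:R <= (1 + rho) * logp (r T / r 0%N).
Proof.
move=> r0 rho0 rm wE wr.
have rk k : r 0%N <= r k by elim: k => // k IH; apply: le_trans IH (rm k).
have rp k : 0 < r k := lt_le_trans r0 (rk k).
have wS k : w k.+1 = w k + r k.+1 by rewrite !wE big_ord_recr.
have w_ge k : k.+1%:R * r 0%N <= w k.
  elim: k => [|k IH]; first by rewrite wE big_ord1 mul1r.
  by rewrite wS -[k.+2%:R]natr1 mulrDl mul1r lerD.
have wp k : 0 < w k.
  by apply: lt_le_trans (w_ge k); rewrite mulr_gt0 ?ltr0n.
have early k : w k <= rho * r 0%N -> k.+1%:R <= rho.
  by move=> h; rewrite -(ler_pM2r r0); apply: le_trans (w_ge k) h.
have rho1 : 0 <= 1 + rho by rewrite addr_ge0 // ltW.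
have rr0 : 0 < rho * r 0%N by rewrite mulr_gt0.
(* The logarithmic count starts only once [w] has reached [rho * r 0]; [early] bounds the number of
   indices before that by [rho]. *)
have step k : (k < T)%N -> rho * r 0%N <= w k ->
    k.+1%:R <= (1 + rho) * logp (w k / (rho * r 0%N)).
  elim: k => [|k IH] kT wk; last first.
    have [wk'|wk'] := leP (w k) (rho * r 0%N).
      apply: (@le_trans _ _ (1 + rho)).
        by rewrite -natr1 addrC lerD2l early.
      rewrite ler_peMr // logp_ge1 //.
      by rewrite ler_pdivlMr // mul1r.
    have := IH (ltnW kT) (ltW wk'); rewrite -[k.+2%:R]natr1 => h.
    have -> : w k.+1 / (rho * r 0%N) = (w k / (rho * r 0%N)) * (w k.+1 / w k).
      by field; rewrite !gt_eqF.
    rewrite /logp lnM ?posrE ?divr_gt0 //.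
    suff : 1 <= (1 + rho) * ln (w k.+1 / w k) by move: h; rewrite /logp; lra.
    have h2 : 1 + rho^-1 <= w k.+1 / w k.
      rewrite wS mulrDl divff ?gt_eqF // lerD2l ler_pdivlMr // mulrC.
      by rewrite ler_pdivrMr // mulrC wr // ltnW.
    have h3 : 1 <= (1 + rho) * ln (1 + rho^-1).
      have p1 : 0 < 1 + rho^-1 by rewrite addr_gt0 ?invr_gt0.
      have := ln_ge_sub_inv p1.
      have -> : 1 - (1 + rho^-1)^-1 = (1 + rho)^-1.
        by field; rewrite !gt_eqF // addr_gt0.
      move=> /(ler_wpM2l rho1); apply: le_trans.
      by rewrite divff // gt_eqF // addr_gt0.
    apply: le_trans h3 _; apply: ler_wpM2l; first by [].
    by rewrite ler_ln ?posrE ?divr_gt0 // addr_gt0 ?invr_gt0.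
  have h : rho <= 1 by move: wk; rewrite wE big_ord1 -{2}[r 0%N]mul1r ler_pM2r.
  apply: (@le_trans _ _ (1 + rho)); first by rewrite lerDl ltW.
  rewrite ler_peMr // logp_ge1 //.
  by rewrite ler_pdivlMr // mul1r.
case: T wr step => [|T] wr step.
  rewrite mulr_ge0 // /logp divff ?gt_eqF // ln1.
  by rewrite addr0 ler01.
have l1 : 1 <= logp (r T.+1 / r 0%N) by rewrite logp_ge1 // ler_pdivlMr // mul1r.
have [wT|wT] := leP (w T) (rho * r 0%N).
  apply: (@le_trans _ _ (1 + rho)).
    by apply: le_trans (early _ wT) _; rewrite lerDr.
  by rewrite ler_peMr.
(* At the last index [w <= rho * r T.+1], which turns [w / (rho * r 0)] into [r T.+1 / r 0]. *)
apply: le_trans (step T (ltnSn T) (ltW wT)) _.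
apply: ler_wpM2l; first by [].
apply: ler_logp; first by rewrite divr_gt0.
rewrite ler_pdivrMr // [leRHS](_ : _ = rho * r T.+1) ?wr //.
by field; rewrite gt_eqF.
Qed.

(** Terms past the point where the running sum exceeds [K ^+ 2] have weight at least [K]; the mass
    before it is at most [K ^+ 2], plus one overshooting term of size at most [B]. *)
Lemma sum_sqrt_mul_ge (q : nat -> R) (K B : R) (t : nat) :
  0 <= K -> 0 <= B ->
  (forall k, 0 <= q k) -> (forall k, (k < t)%N -> q k <= B) ->
  K * (\sum_(i < t) q i - K ^+ 2 - B)
    <= \sum_(k < t) Num.sqrt (\sum_(i < k) q i) * q k.
Proof.
move=> K0 B0 q0; elim: t => [|t IH] qB.
  by rewrite !big_ord0; nra.
have h := IH (fun k kt => qB k (leqW kt)).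
rewrite big_ord_recr /= [leRHS]big_ord_recr /=.
have sum_ge0 : 0 <= \sum_(k < t) Num.sqrt (\sum_(i < k) q i) * q k.
  by apply: sumr_ge0 => k _; rewrite mulr_ge0 ?sqrtr_ge0.
have Q0 : 0 <= \sum_(i < t) q i by rewrite sumr_ge0.
have [QK|QK] := leP (\sum_(i < t) q i) (K ^+ 2).
  have s0 := mulr_ge0 (sqrtr_ge0 (\sum_(i < t) q i)) (q0 t).
  apply: (@le_trans _ _ 0); last by rewrite addr_ge0.
  have := qB t (ltnSn t); move: QK; nra.
have sK : K <= Num.sqrt (\sum_(i < t) q i).
  by rewrite -[leLHS]ger0_norm // -sqrtr_sqr ler_wsqrtr // ltW.
have := q0 t; nra.
Qed.

End Sequences.

(** * Error of a single step against a logarithmic potential *)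

Section StepSizes.
Variable R : realType.
Implicit Types (A q M : R).

(* With [D'] and [D] the denominators of [eta_x] and [eta_y], the error of one step relative to [D]
   is dominated by the increment of the bounded potential [- 1 / logp]. *)
Lemma step_error_le (A0 A q M : R) :
  0 < A0 -> A0 <= A -> 0 <= q -> 0 <= M ->
  let L := logp (A / A0) in
  let L' := logp ((A + q) / A0) in
  let D' := 12 * L ^+ 2 * Num.sqrt (Num.max A M) in
  let D := 12 * L' ^+ 2 * Num.sqrt (Num.max (A + q) M) in
  is_true ((q / D + (D'^-1 - D^-1) * (Num.sqrt q * Num.sqrt M)) / D
             <= (L^-1 - L'^-1) / 36).
Proof.
move=> A00 A0A q0 M0 L L' D' D.
have A_gt0 : 0 < A by apply: lt_le_trans A0A.
have Aq_gt0 : 0 < A + q by rewrite ltr_pwDl.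
pose s := Num.sqrt (Num.max A M); pose s' := Num.sqrt (Num.max (A + q) M).
have s_gt0 : 0 < s by rewrite sqrtr_gt0 lt_max A_gt0.
have s'_gt0 : 0 < s' by rewrite sqrtr_gt0 lt_max Aq_gt0.
have sqs : s ^+ 2 = Num.max A M by rewrite sqr_sqrtr // le_max ltW.
have sqs' : s' ^+ 2 = Num.max (A + q) M by rewrite sqr_sqrtr // le_max ltW.
have xs : Num.sqrt q <= s' by rewrite ler_wsqrtr // le_max lerDr ltW.
have ms : Num.sqrt M <= s by rewrite ler_wsqrtr // le_max lexx orbT.
have L1 : 1 <= L by rewrite logp_ge1 // ler_pdivlMr // mul1r.
have dL : q / (A + q) <= L' - L.
  have -> : L' - L = ln ((A + q) / A).
    have -> : (A + q) / A = ((A + q) / A0) / (A / A0).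
      by field; rewrite !gt_eqF.
    by rewrite ln_div ?posrE ?divr_gt0 // /L' /L /logp; ring.
  have := ln_ge_sub_inv (divr_gt0 Aq_gt0 A_gt0); apply: le_trans.
  by rewrite le_eqVlt; apply/orP; left; apply/eqP; field; rewrite !gt_eqF.
have LL' : L <= L'.
  by rewrite -subr_ge0; apply: le_trans dL; rewrite divr_ge0 // ltW.
have sqs'_ge : A + q <= s' ^+ 2 by rewrite sqs' le_max lexx.
have qs' : q / s' ^+ 2 <= L' - L.
  apply: le_trans dL; apply: ler_wpM2l => //.
  by rewrite lef_pV2 ?posrE ?exprn_gt0.
have ss' : s <= s' by rewrite ler_wsqrtr // ge_max !le_max lerDl q0 lexx orbT.
(* Here [(s / s')^2 >= A / (A + q)], and [s / s' <= 1] lets the square be replaced by [s / s']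
   itself. *)
have ds : 1 - s / s' <= L' - L.
  apply: le_trans dL.
  have sgs : 1 - q / (A + q) <= (s / s') ^+ 2.
    rewrite expr_div_n ler_pdivlMr ?exprn_gt0 // sqs sqs'.
    have -> : 1 - q / (A + q) = A / (A + q) by field; rewrite gt_eqF.
    rewrite mulrAC ler_pdivrMr //.
    by case: (leP (A + q) M) => h1; case: (leP A M) => h2; nra.
  have t0 : 0 <= s / s' by rewrite divr_ge0 // ltW.
  have t1 : s / s' <= 1 by rewrite ler_pdivrMr // mul1r.
  move: sgs; nra.
have L_gt0 : 0 < L by apply: lt_le_trans L1.
have L'_gt0 : 0 < L' by apply: lt_le_trans LL'.
have -> : (q / D + (D'^-1 - D^-1) * (Num.sqrt q * Num.sqrt M)) / D =
   144^-1 * (q / s' ^+ 2 / L' ^+ 4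
   + (1 - (L / L') ^+ 2 * (s / s')) * (Num.sqrt q / s') * (Num.sqrt M / s)
       / (L ^+ 2 * L' ^+ 2)).
  by rewrite /D /D' -/s -/s'; field; rewrite !gt_eqF.
(* Of the four shares in [4 / 144 = 1 / 36], one pays for the first summand and three for the
   second. *)
have -> : (L^-1 - L'^-1) / 36 = 144^-1 * ((L' - L) / (L * L') + 3 * (L' - L) / (L * L')).
  by field; rewrite !gt_eqF.
apply: ler_wpM2l; first by rewrite invr_ge0.
have L'1 : 1 <= L' by apply: le_trans LL'.
have dL0 : 0 <= L' - L by rewrite subr_ge0.
apply: lerD.
  apply: ler_pM => //.
  - by rewrite divr_ge0 // sqr_ge0.
  - by rewrite invr_ge0 exprn_ge0 // ltW.
  rewrite lef_pV2 ?posrE ?mulr_gt0 ?exprn_gt0 //.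
  have -> : L' ^+ 4 = (L' * L') * (L' * L') by ring.
  have h : L * L' <= L' * L' by rewrite ler_wpM2r // ltW.
  apply: le_trans h _; rewrite ler_peMl ?mulr_ge0 ?(ltW L'_gt0) //.
  by rewrite -[1]mulr1 ler_pM.
have t0 : 0 <= s / s' by rewrite divr_ge0 // ltW.
have t1 : s / s' <= 1 by rewrite ler_pdivrMr // mul1r.
have u0 : 0 <= L / L' by rewrite divr_ge0 // ltW.
have u1 : L / L' <= 1 by rewrite ler_pdivrMr // mul1r.
have du : 1 - L / L' <= L' - L.
  have -> : 1 - L / L' = (L' - L) / L' by field; rewrite gt_eqF.
  by rewrite ler_pdivrMr // ler_peMr.
have inv : (L ^+ 2 * L' ^+ 2)^-1 <= (L * L')^-1.
  rewrite lef_pV2 ?posrE ?mulr_gt0 ?exprn_gt0 // -exprMn expr2.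
  have h : 1 <= L * L' by rewrite -[1]mulr1 ler_pM.
  by rewrite ler_peMr // (le_trans ler01).
have x1 : Num.sqrt q / s' <= 1 by rewrite ler_pdivrMr // mul1r.
have m1 : Num.sqrt M / s <= 1 by rewrite ler_pdivrMr // mul1r.
have x0 : 0 <= Num.sqrt q / s' by rewrite divr_ge0 ?sqrtr_ge0 // ltW.
have m0 : 0 <= Num.sqrt M / s by rewrite divr_ge0 ?sqrtr_ge0 // ltW.
have z0 : 0 <= 1 - (L / L') ^+ 2 * (s / s').
  by rewrite subr_ge0 mulr_ile1 ?sqr_ge0 ?exprn_ile1.
(* Splits [1 - u^2 t] as [(1 - u^2) + u^2 (1 - t)]: two units of [L' - L] for [u = L / L'] and one
   for [t = s / s']. *)
have z1 : 1 - (L / L') ^+ 2 * (s / s') <= 3 * (L' - L).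
  have h1 : 1 - (L / L') ^+ 2 <= 2 * (L' - L) by move: u0 u1 du; nra.
  have h2 : 0 <= (L / L') ^+ 2 by rewrite sqr_ge0.
  have h3 : (L / L') ^+ 2 <= 1 by rewrite exprn_ile1.
  by move: t0 t1 ds; nra.
apply: ler_pM => //.
- by apply: mulr_ge0 => //; apply: mulr_ge0.
- by rewrite invr_ge0 mulr_ge0 ?exprn_ge0 // ltW.
apply: le_trans z1.
by rewrite -mulrA ler_piMr // mulr_ile1.
Qed.

End StepSizes.

(** * Subgradients, Lipschitz bounds and smoothness *)

Section Gradients.
Variables (R : realType) (n : nat) (f : 'rV[R]_n -> R).
Variables (grad : 'rV[R]_n -> 'rV[R]_n) (xstar : 'rV[R]_n).
Hypothesis grad_sub : is_subgrad_oracle f grad.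
Hypothesis xstar_min : forall u, f xstar <= f u.

Lemma sub_le_dotv_grad u v : f u - f v <= dotv (grad u) (u - v).
Proof.
have := grad_sub u v; rewrite -opprB dotvNr; lra.
Qed.

(** The subgradient inequality is tested at [u + grad u], where [f] has grown by at least
    [||grad u||^2]. *)
Lemma enorm_grad_le (G : R) u : 0 <= G -> lipschitz_fun G f -> enorm (grad u) <= G.
Proof.
move=> G0 lipf; have [->|g0] := eqVneq (grad u) 0; first by rewrite enorm0.
have gp : 0 < enorm (grad u) by rewrite enorm_gt0.
have := grad_sub u (u + grad u); have := lipf (u + grad u) u.
rewrite (addrAC u) subrr add0r -enorm_sqr => /(le_trans (ler_norm _)) h1 h2.
rewrite -(ler_pM2r gp); move: h1 h2; rewrite expr2; lra.
Qed.

Section Smooth.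
Variable b : R.
Hypothesis grad_lip : smooth_fun b grad.

(** For [b <= 0] the gradient would be constant and nonzero, and moving from [xstar] against it
    would lower [f] below its minimum. *)
Lemma smooth_gt0 u : grad u != 0 -> 0 < b.
Proof.
move=> gu; rewrite ltNge; apply/negP => b0.
have gE v : grad v = grad u.
  apply/eqP; rewrite -subr_eq0; have := grad_lip v u.
  have := enorm_ge0 (v - u); rewrite -[_ == 0]negbK -enorm_gt0 -leNgt.
  by move=> h1 h2; apply: le_trans h2 _; rewrite mulr_le0_ge0.
have := sub_le_dotv_grad (xstar - grad u) xstar; have := xstar_min (xstar - grad u).
rewrite (gE (xstar - _)) (addrAC xstar) subrr add0r dotvNr -enorm_sqr.
have : 0 < enorm (grad u) ^+ 2 by rewrite exprn_gt0 // enorm_gt0.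
lra.
Qed.

(** Follows from the subgradient inequality at [v] and Cauchy-Schwarz, without integration; the
    price is the constant [b] in place of [b / 2]. *)
Lemma smooth_upper u v :
  f v <= f u + dotv (grad u) (v - u) + b * enorm (v - u) ^+ 2.
Proof.
have := sub_le_dotv_grad v u.
have := dotv_le (grad v - grad u) (v - u); rewrite dotvBl.
have := ler_wpM2r (enorm_ge0 (v - u)) (grad_lip v u); rewrite expr2; lra.
Qed.

Lemma enorm_grad_sqr_le u : 0 < b -> enorm (grad u) ^+ 2 <= 4 * b * (f u - f xstar).
Proof.
(* The step length [1 / (2 b)] minimises the quadratic upper bound along the negative gradient. *)
move=> b0; set s := (2 * b)^-1.
have := smooth_upper u (u - s *: grad u); have := xstar_min (u - s *: grad u).
rewrite (addrAC u) subrr add0r dotvNr dotvZr -enorm_sqr enormN enormZ exprMn.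
rewrite real_normK ?num_real // => h1 h2.
have : enorm (grad u) ^+ 2 * (s - b * s ^+ 2) <= f u - f xstar by lra.
have -> : s - b * s ^+ 2 = (4 * b)^-1 by rewrite /s; field; rewrite gt_eqF.
by rewrite ler_pdivrMr ?mulr_gt0 // mulrC.
Qed.

Lemma grad_min : 0 < b -> grad xstar = 0.
Proof.
move=> b0; have := enorm_grad_sqr_le xstar b0; rewrite subrr mulr0 enorm_sqr.
by move=> h; apply/eqP; rewrite -dotvv_eq0 eq_le h dotvv_ge0.
Qed.

End Smooth.
End Gradients.

(** * Radii, weights and weighted averages *)

Section Averages.
Variables (R : realType) (n : nat) (reps : R) (x y : nat -> 'rV[R]_n).
Hypothesis reps_gt0 : 0 < reps.

Local Notation r := (rbar reps x y).
Local Notation al := (alpha reps x y).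
Local Notation w := (wgt reps x y).

Lemma rbar_ge_reps t : reps <= r t.
Proof. exact: bigmax_ge_id. Qed.

Lemma rbar_gt0 t : 0 < r t.
Proof. exact: lt_le_trans (rbar_ge_reps t). Qed.
Hint Resolve rbar_gt0 : core.

Lemma rbar_ge0 t : 0 <= r t.
Proof. exact: ltW. Qed.
Hint Resolve rbar_ge0 : core.

Lemma rbar_ge_max k t : (k <= t)%N ->
  Num.max (enorm (y k - x 0%N)) (enorm (x k - x 0%N)) <= r t.
Proof.
rewrite -ltnS => kt.
exact: (le_bigmax _ (fun k : 'I_t.+1 => Num.max (enorm (y k - x 0%N)) (enorm (x k - x 0%N)))
          (Ordinal kt)).
Qed.

Lemma enorm_y_le_rbar k t : (k <= t)%N -> enorm (y k - x 0%N) <= r t.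
Proof. by move=> /rbar_ge_max; rewrite ge_max => /andP[]. Qed.

Lemma rbar_leP t (B : R) :
  reps <= B -> (forall k, (k <= t)%N -> enorm (y k - x 0%N) <= B) ->
  (forall k, (k <= t)%N -> enorm (x k - x 0%N) <= B) -> r t <= B.
Proof.
move=> eB yB xB; apply: bigmax_le => // k _.
by rewrite ge_max yB ?xB // -ltnS.
Qed.

Lemma rbar_le k t : (k <= t)%N -> r k <= r t.
Proof.
move=> kt; exact: (le_bigmax_ord xpredT
  (fun i => Num.max (enorm (y i - x 0%N)) (enorm (x i - x 0%N)))).
Qed.

Lemma rbar_leS t : r t <= r t.+1.
Proof. exact: rbar_le. Qed.

Lemma rbarS_le t (B : R) :
  r t <= B -> enorm (y t.+1 - x 0%N) <= B -> enorm (x t.+1 - x 0%N) <= B -> r t.+1 <= B.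
Proof.
move=> rB yB xB; apply: rbar_leP; first exact: le_trans (rbar_ge_reps t) rB.
  move=> k; rewrite leq_eqVlt ltnS => /orP[/eqP -> //|kt].
  exact: le_trans (enorm_y_le_rbar kt) rB.
move=> k; rewrite leq_eqVlt ltnS => /orP[/eqP -> //|kt].
by apply: le_trans rB; have := rbar_ge_max kt; rewrite ge_max => /andP[].
Qed.

Lemma wgtE t : w t = \sum_(k < t.+1) r k.
Proof. by rewrite /wgt /alpha divfK // gt_eqF. Qed.

Lemma wgt_gt0 t : 0 < w t.
Proof.
rewrite wgtE big_ord_recr /= ltr_wpDl //; apply: sumr_ge0 => k _; exact: rbar_ge0.
Qed.
Hint Resolve wgt_gt0 : core.

Lemma alpha_gt0 t : 0 < al t.
Proof. by rewrite -(pmulr_lgt0 _ (rbar_gt0 t)) wgt_gt0. Qed.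
Hint Resolve alpha_gt0 : core.

Lemma alpha_le t : al t <= t.+1%:R.
Proof.
rewrite /alpha ler_pdivrMr // mulr_natl -[X in _ *+ X]card_ord -sumr_const.
by apply: ler_sum => k _; rewrite rbar_le // -ltnS.
Qed.

Definition wgt_sum t := \sum_(k < t.+1) w k.
Local Notation S := wgt_sum.

Lemma wgt_sumS t : S t.+1 = S t + w t.+1.
Proof. by rewrite /S big_ord_recr. Qed.

Lemma wgt_sum_gt0 t : 0 < S t.
Proof.
rewrite /S big_ord_recr /= ltr_wpDl //; apply: sumr_ge0 => k _; exact: ltW.
Qed.
Hint Resolve wgt_sum_gt0 : core.

Lemma sqr_wgt_le t : w t ^+ 2 <= 2 * r t * S t.
Proof. exact: (sqr_sum_le t rbar_ge0 rbar_leS wgtE). Qed.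

Lemma sqr_alpha_le t : al t ^+ 2 <= 2 * S t / r t.
Proof.
rewrite ler_pdivlMr // -(ler_pM2r (rbar_gt0 t)).
by have := sqr_wgt_le t; rewrite /wgt exprMn; lra.
Qed.

Lemma sum_wgt_xbar t : \sum_(k < t.+1) w k *: x k.+1 = S t *: xbar reps x y t.
Proof. by rewrite /xbar scalerA divff ?scale1r // gt_eqF. Qed.

Lemma xbarS t :
  S t.+1 *: xbar reps x y t.+1 = S t *: xbar reps x y t + w t.+1 *: x t.+2.
Proof. by rewrite -!sum_wgt_xbar [LHS]big_ord_recr. Qed.

(** The two averages differ only in their last point, so the query points of [g_t] and [m_t] are as
    far apart as [x_{t+1}] and [y_t], shrunk by [w_t / S_t]. *)
Lemma xbar_sub_zbar t :
  xbar reps x y t - zbar reps x y t = (w t / S t) *: (x t.+1 - y t).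
Proof.
rewrite /xbar /zbar -/(S t) [X in _ *: X - _]big_ord_recr /=.
rewrite -scalerBr [w t / _]mulrC -[RHS]scalerA.
by congr (_ *: _); apply/rowP => i; rewrite !mxE; ring.
Qed.

Lemma zbar0 : zbar reps x y 0 = y 0%N.
Proof.
by rewrite /zbar big_ord0 addr0 big_ord1 scalerA mulVf ?scale1r // gt_eqF.
Qed.

(** Since gradients are taken at the running averages, each new term splits into a comparison with
    [u] and one with the previous average; the subgradient inequality handles both, and the result
    telescopes. *)
Lemma online_to_batch (f : 'rV[R]_n -> R) grad u t :
  is_subgrad_oracle f grad ->
  S t * (f (xbar reps x y t) - f u)
    <= \sum_(k < t.+1) w k * dotv (gg grad reps x y k) (x k.+1 - u).
Proof.
move=> fg; rewrite /gg; elim: t => [|t IH].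
  rewrite /S !big_ord1 ler_pM2l //.
  have -> : x 1%N = xbar reps x y 0.
    by rewrite /xbar !big_ord1 scalerA mulVf ?scale1r // gt_eqF.
  exact: sub_le_dotv_grad.
rewrite big_ord_recr /=; apply: le_trans (lerD IH (lexx _)).
set g := grad _.
have -> : w t.+1 * dotv g (x t.+2 - u) =
   w t.+1 * dotv g (xbar reps x y t.+1 - u)
   + S t * dotv g (xbar reps x y t.+1 - xbar reps x y t).
  rewrite -!dotvZr -dotvDr; congr (dotv _ _).
  apply/rowP => i; move/rowP: (xbarS t) => /(_ i).
  by rewrite wgt_sumS !mxE; lra.
have := sub_le_dotv_grad fg (xbar reps x y t.+1) u.
have := sub_le_dotv_grad fg (xbar reps x y t.+1) (xbar reps x y t).
have := wgt_gt0 t.+1; have := wgt_sum_gt0 t; rewrite wgt_sumS -/g; nra.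
Qed.

End Averages.

(** * Iterates of a run: step sizes, stability and regret *)

Section Run.
Variables (R : realType) (n : nat) (f : 'rV[R]_n -> R).
Variables (grad : 'rV[R]_n -> 'rV[R]_n) (xstar : 'rV[R]_n) (reps : R).
Variables (x y : nat -> 'rV[R]_n) (T : nat).
Hypothesis grad_sub : is_subgrad_oracle f grad.
Hypothesis xstar_min : forall u, f xstar <= f u.
Hypothesis reps_gt0 : 0 < reps.
Hypothesis reps_le : reps <= enorm (x 0%N - xstar).
Hypothesis grad0 : grad (x 0%N) != 0.
Hypothesis run : udog_run grad reps x y T.

Local Notation r := (rbar reps x y).
Local Notation al := (alpha reps x y).
Local Notation w := (wgt reps x y).
Local Notation S := (wgt_sum reps x y).
Local Notation m := (mm grad reps x y).
Local Notation g := (gg grad reps x y).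
Local Notation q := (qq grad reps x y).
Local Notation M := (MM grad reps x y).
Local Notation d0 := (enorm (x 0%N - xstar)).
Local Notation gap t := (f (xbar reps x y t) - f xstar).

(* [Gsum t], [Lfac t], [Dx t] and [Dy t] are ||m_0||^2 + Q_{t-1}, its log_+ after division by
   ||m_0||^2, r_t / eta_{x,t} and r_t / eta_{y,t}. *)
Definition Gsum t := enorm (m 0%N) ^+ 2 + Qprev grad reps x y t.
Definition Lfac t := logp (Gsum t / enorm (m 0%N) ^+ 2).
Definition Dx t := 12 * Lfac t ^+ 2 * Num.sqrt (Num.max (Gsum t) (M t)).
Definition Dy t := 12 * Lfac t.+1 ^+ 2 * Num.sqrt (Num.max (Gsum t.+1) (M t)).

Let norm_ge0 (u : 'rV[R]_n) : 0 <= enorm u := enorm_ge0 u.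
Let r_gt0 t : 0 < r t := rbar_gt0 x y reps_gt0 t.
Let r_ge0 t : 0 <= r t := rbar_ge0 x y reps_gt0 t.
Let al_gt0 t : 0 < al t := alpha_gt0 x y reps_gt0 t.
Let al_ge0 t : 0 <= al t := ltW (al_gt0 t).
Let w_gt0 t : 0 < w t := wgt_gt0 x y reps_gt0 t.
Let S_gt0 t : 0 < S t := wgt_sum_gt0 x y reps_gt0 t.
Hint Resolve norm_ge0 r_gt0 r_ge0 al_gt0 al_ge0 w_gt0 S_gt0 : core.

Lemma d0_gt0 : 0 < d0.
Proof. exact: lt_le_trans reps_gt0 reps_le. Qed.
Hint Resolve d0_gt0 : core.

Lemma mm0 : m 0%N = grad (x 0%N).
Proof. by rewrite /mm zbar0 //; case: run => ->. Qed.

Lemma mm0_gt0 : 0 < enorm (m 0%N) ^+ 2.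
Proof. by rewrite exprn_gt0 // enorm_gt0 mm0. Qed.

Lemma qq_ge0 t : 0 <= q t.
Proof. by rewrite mulr_ge0 ?sqr_ge0. Qed.
Hint Resolve qq_ge0 : core.

Lemma qq_sqrt t : Num.sqrt (q t) = al t * enorm (g t - m t).
Proof. by rewrite /qq -exprMn sqrtr_sqr ger0_norm // mulr_ge0 // ltW. Qed.

Lemma Qprev_ge0 t : 0 <= Qprev grad reps x y t.
Proof. exact: sumr_ge0. Qed.

Lemma GsumS t : Gsum t.+1 = Gsum t + q t.
Proof. by rewrite /Gsum /Qprev big_ord_recr addrA. Qed.

Lemma Gsum_ge t : enorm (m 0%N) ^+ 2 <= Gsum t.
Proof. by rewrite lerDl Qprev_ge0. Qed.

Lemma Gsum_gt0 t : 0 < Gsum t.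
Proof. exact: lt_le_trans mm0_gt0 (Gsum_ge t). Qed.
Hint Resolve Gsum_gt0 : core.

Lemma Gsum_leS t : Gsum t <= Gsum t.+1.
Proof. by rewrite GsumS lerDl. Qed.

Lemma Gsum_le k t : (k <= t)%N -> Gsum k <= Gsum t.
Proof. by move: k t; apply/nondecreasing_seqP; exact: Gsum_leS. Qed.

Lemma Lfac_ge1 t : 1 <= Lfac t.
Proof. by rewrite logp_ge1 // ler_pdivlMr ?mm0_gt0 // mul1r Gsum_ge. Qed.
Hint Resolve Lfac_ge1 : core.

Lemma Lfac_gt0 t : 0 < Lfac t.
Proof. exact: lt_le_trans (Lfac_ge1 t). Qed.
Hint Resolve Lfac_gt0 : core.

Lemma Lfac_le k t : (k <= t)%N -> Lfac k <= Lfac t.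
Proof.
move=> kt; apply: ler_logp; first by rewrite divr_gt0 ?mm0_gt0.
by rewrite ler_pM2r ?invr_gt0 ?mm0_gt0 // Gsum_le.
Qed.

Lemma MM_le k t : (k <= t)%N -> M k <= M t.
Proof.
move=> kt; exact: (le_bigmax_ord xpredT
  (fun k => al k ^+ 2 * enorm (m k) ^+ 2)).
Qed.

Lemma MM_ge t : al t ^+ 2 * enorm (m t) ^+ 2 <= M t.
Proof.
exact: (le_bigmax _ (fun k : 'I_t.+1 => al k ^+ 2 * enorm (m k) ^+ 2) ord_max).
Qed.

Lemma MM_ge0 t : 0 <= M t.
Proof. exact: bigmax_ge_id. Qed.
Hint Resolve MM_ge0 : core.

Lemma alpha_mm_le t : al t * enorm (m t) <= Num.sqrt (M t).
Proof.
have h : 0 <= al t * enorm (m t) by rewrite mulr_ge0 // ltW.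
by rewrite -(ger0_norm h) -sqrtr_sqr ler_wsqrtr // exprMn MM_ge.
Qed.

Let sqrt_max_mul_le (a b A B : R) : 1 <= a -> a <= b -> A <= B ->
  12 * a ^+ 2 * Num.sqrt A <= 12 * b ^+ 2 * Num.sqrt B.
Proof.
move=> a1 ab AB; apply: ler_pM; rewrite ?sqrtr_ge0 ?ler_wsqrtr //.
  by rewrite mulr_ge0 ?sqr_ge0.
by rewrite ler_pM2l // sqr_le //; lra.
Qed.

Lemma Dx_le_Dy t : Dx t <= Dy t.
Proof.
apply: sqrt_max_mul_le; rewrite ?Lfac_le //.
by rewrite ge_max !le_max lexx Gsum_leS orbT.
Qed.

Lemma Dy_le_DxS t : Dy t <= Dx t.+1.
Proof.
apply: sqrt_max_mul_le => //.
by rewrite ge_max !le_max lexx (MM_le (leqnSn t)) orbT.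
Qed.

Lemma Dx_ge (a : R) t : a <= Num.max (Gsum t) (M t) -> 12 * Num.sqrt a <= Dx t.
Proof.
move=> aM; have := sqrt_max_mul_le (lexx 1) (Lfac_ge1 t) aM.
by rewrite expr1n mulr1.
Qed.

Lemma Dx_gt0 t : 0 < Dx t.
Proof.
apply: lt_le_trans (@Dx_ge (Gsum t) t _); last by rewrite le_max lexx.
by rewrite mulr_gt0 // sqrtr_gt0.
Qed.
Hint Resolve Dx_gt0 : core.

Lemma Dy_gt0 t : 0 < Dy t.
Proof. exact: lt_le_trans (Dx_gt0 t) (Dx_le_Dy t). Qed.
Hint Resolve Dy_gt0 : core.

Lemma Dy_leS t : Dy t <= Dy t.+1.
Proof. exact: le_trans (Dy_le_DxS t) (Dx_le_Dy _). Qed.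

Lemma Dy_le k t : (k <= t)%N -> Dy k <= Dy t.
Proof. by move: k t; apply/nondecreasing_seqP; exact: Dy_leS. Qed.

Lemma run_x t : (t < T)%N -> Dx t *: (y t - x t.+1) = (r t * al t) *: m t.
Proof.
case: run => _ /[apply] -[-> _]; rewrite opprB addrC subrK scalerA; congr (_ *: _).
by rewrite /eta_x -/(Gsum t) -/(Lfac t) -/(Dx t); field; rewrite gt_eqF.
Qed.

Lemma run_y t : (t < T)%N -> Dy t *: (y t - y t.+1) = (r t * al t) *: g t.
Proof.
case: run => _ /[apply] -[_ ->]; rewrite opprB addrC subrK scalerA; congr (_ *: _).
by rewrite /eta_y -/(Gsum t.+1) -/(Lfac t.+1) -/(Dy t); field; rewrite gt_eqF.
Qed.

(** This is the role of [M t] in the step size: it forces [Dx t >= 12 * al t * ||m_t||]. *)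
Lemma x_step_le t : (t < T)%N -> enorm (x t.+1 - y t) <= r t / 12.
Proof.
move=> tT; rewrite enormBC -(ler_pM2l (Dx_gt0 t)) -{1}[Dx t]ger0_norm; last exact: ltW.
rewrite -enormZ run_x // enormZ (ger0_norm (mulr_ge0 (r_ge0 t) (al_ge0 t))) -mulrA.
have := @Dx_ge (M t) t; rewrite le_max lexx orbT => /(_ isT) h.
have := alpha_mm_le t; have := r_gt0 t; nra.
Qed.

(** The part [m_t] of the gradient is capped by [M t] and the part [g_t - m_t] by [Gsum t.+1], each
    contributing [r t / 12]. *)
Lemma y_step_le t : (t < T)%N -> enorm (y t.+1 - y t) <= r t / 6.
Proof.
move=> tT; rewrite enormBC -(ler_pM2l (Dy_gt0 t)) -{1}[Dy t]ger0_norm; last exact: ltW.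
rewrite -enormZ run_y // enormZ (ger0_norm (mulr_ge0 (r_ge0 t) (al_ge0 t))) -mulrA.
have h1 : al t * enorm (g t) <= al t * enorm (m t) + Num.sqrt (q t).
  rewrite qq_sqrt -mulrDr ler_pM2l // -{1}[g t](subrK (m t)) addrC.
  exact: le_trans (enormD _ _) _.
have h2 : 12 * Num.sqrt (M t) <= Dy t.
  apply: le_trans (Dx_le_Dy t); apply: Dx_ge; by rewrite le_max lexx orbT.
have h3 : 12 * Num.sqrt (q t) <= Dy t.
  apply: le_trans (sqrt_max_mul_le (lexx 1) (Lfac_ge1 t.+1) (_ : _ <= Num.max (Gsum t.+1) (M t))).
    by rewrite expr1n mulr1.
  by rewrite le_max GsumS lerDr ltW.
have := alpha_mm_le t; have := r_gt0 t; nra.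
Qed.

Lemma rbarS_ratio t : (t < T)%N -> r t.+1 <= 7 / 6 * r t.
Proof.
move=> tT; have rt := r_gt0 t; apply: rbarS_le; first by lra.
  apply: le_trans (enormB_le _ (y t) _) _.
  by have := enorm_y_le_rbar reps x y (leqnn t); have := y_step_le tT; lra.
apply: le_trans (enormB_le _ (y t) _) _.
by have := enorm_y_le_rbar reps x y (leqnn t); have := x_step_le tT; lra.
Qed.

(** Cost of using [m_t] as a prediction of [g_t], the usual error term of optimistic gradient
    methods. *)
Definition step_error t := r t * al t * dotv (g t - m t) (x t.+1 - y t.+1).

Lemma one_step t : (t < T)%N ->
  w t * dotv (g t) (x t.+1 - xstar)
    <= Dy t * (enorm (y t - xstar) ^+ 2 - enorm (y t.+1 - xstar) ^+ 2) / 2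
       + step_error t - Dx t * enorm (y t - x t.+1) ^+ 2 / 2.
Proof.
move=> tT; rewrite /step_error.
have -> : w t = r t * al t by rewrite /wgt mulrC.
rewrite -!dotvZl scalerBr -run_x // -run_y //.
set u := y t - x t.+1; set v := y t - y t.+1; set p := y t - xstar.
have -> : x t.+1 - xstar = p - u by apply/rowP => i; rewrite !mxE; ring.
have -> : x t.+1 - y t.+1 = v - u by apply/rowP => i; rewrite !mxE; ring.
have -> : y t.+1 - xstar = p - v by apply/rowP => i; rewrite !mxE; ring.
(* The slack of the inequality is [Dx ||u - v||^2 / 2 + (Dy - Dx) ||v||^2 / 2]. *)
clearbody u v p; have := mulr_ge0 (ltW (Dx_gt0 t)) (dotvv_ge0 (u - v)).
have := Dx_le_Dy t; have := dotvv_ge0 v.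
rewrite !enorm_sqr !dotvE (dotvC v u) (dotvC v p); nra.
Qed.

Lemma step_error_rel t : (t < T)%N ->
  step_error t / Dy t <= r t ^+ 2 * (((Lfac t)^-1 - (Lfac t.+1)^-1) / 36).
Proof.
move=> tT.
have := @step_error_le R _ _ (q t) (M t) mm0_gt0 (Gsum_ge t) (qq_ge0 t) (MM_ge0 t).
cbv zeta; rewrite -GsumS -/(Lfac t) -/(Lfac t.+1) -/(Dx t) -/(Dy t) => h.
apply: le_trans (ler_wpM2l (sqr_ge0 (r t)) h).
rewrite mulrA; apply: ler_wpM2r; first by rewrite invr_ge0 ltW.
set e := g t - m t; set dm := al t ^+ 2 * dotv e (m t).
(* One part of the error is [q_t / Dy t]; the other is the mismatch of the two step sizes acting on
   [m_t], controlled by Cauchy-Schwarz. *)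
have -> : step_error t = r t ^+ 2 * (q t / Dy t - ((Dx t)^-1 - (Dy t)^-1) * dm).
  have xE : y t - x t.+1 = (r t * al t / Dx t) *: m t.
    by rewrite mulrC -scalerA -run_x // scalerA mulVf ?scale1r // gt_eqF.
  have yE : y t - y t.+1 = (r t * al t / Dy t) *: g t.
    by rewrite mulrC -scalerA -run_y // scalerA mulVf ?scale1r // gt_eqF.
  have qE : q t = al t ^+ 2 * (dotv e (g t) - dotv e (m t)).
    by rewrite /qq enorm_sqr -dotvBr.
  rewrite /step_error -/e qE /dm (_ : x t.+1 - y t.+1 = (y t - y t.+1) - (y t - x t.+1)).
    by rewrite xE yE dotvBr !dotvZr; field; rewrite !gt_eqF.
  by apply/rowP => i; rewrite !mxE; ring.
apply: ler_wpM2l; first exact: sqr_ge0.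
rewrite lerD2l -mulrN; apply: ler_wpM2l.
  by rewrite subr_ge0 lef_pV2 ?posrE // Dx_le_Dy.
have := ler_wpM2l (sqr_ge0 (al t)) (dotv_ge e (m t)).
have := ler_wpM2l (mulr_ge0 (al_ge0 t) (norm_ge0 e)) (alpha_mm_le t).
by rewrite qq_sqrt -/e -/dm; lra.
Qed.

(* Dividing by the nondecreasing [Dy] keeps the weighted regret nonnegative and makes the distances
   telescope. *)
Lemma dist_sqr_le t : (t < T)%N ->
  enorm (y t.+1 - xstar) ^+ 2 <= d0 ^+ 2 + r t ^+ 2 / 18.
Proof.
move=> tT.
pose p k := w k * dotv (g k) (x k.+1 - xstar).
have tk k : (k <= t)%N -> (k < T)%N by move=> kt; apply: leq_ltn_trans tT.
(* Partial sums of [p] dominate [S k] times an optimality gap, hence are nonnegative. *)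
have H0 : 0 <= \sum_(k < t.+1) p k / Dy k.
  apply: sum_scaled_ge0 => [k _ //|k _|k kt]; first exact: Dy_leS.
  apply: le_trans (online_to_batch x y reps_gt0 xstar k grad_sub).
  by rewrite mulr_ge0 ?subr_ge0 // ltW.
have : \sum_(k < t.+1) p k / Dy k <=
   \sum_(k < t.+1) ((enorm (y k - xstar) ^+ 2 - enorm (y k.+1 - xstar) ^+ 2) / 2
     + r t ^+ 2 / 36 * ((Lfac k)^-1 - (Lfac k.+1)^-1)).
  apply: ler_sum => -[k /= kt] _; rewrite ltnS in kt.
  have h1 := one_step (tk k kt); have h2 := step_error_rel (tk k kt).
  have h3 : r k ^+ 2 * (((Lfac k)^-1 - (Lfac k.+1)^-1) / 36)
      <= r t ^+ 2 * (((Lfac k)^-1 - (Lfac k.+1)^-1) / 36).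
    apply: ler_wpM2r.
      by rewrite divr_ge0 // subr_ge0 lef_pV2 ?posrE // Lfac_le.
    by rewrite sqr_le // rbar_le.
  have h4 : p k <= Dy k * (enorm (y k - xstar) ^+ 2 - enorm (y k.+1 - xstar) ^+ 2) / 2
       + step_error k.
    apply: le_trans h1 _; rewrite gerBl.
    by rewrite divr_ge0 // mulr_ge0 ?sqr_ge0 // ltW.
  have h5 := ler_wpM2r (ltW (_ : 0 < (Dy k)^-1)) h4.
  rewrite invr_gt0 in h5; have := h5 (Dy_gt0 k); rewrite mulrDl.
  rewrite [X in X + _](_ : _ =
    (enorm (y k - xstar) ^+ 2 - enorm (y k.+1 - xstar) ^+ 2) / 2).
    by lra.
  by field; rewrite gt_eqF.
rewrite big_split /= -mulr_suml -mulr_sumr => H1.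
have := le_trans H0 H1.
rewrite (telescope_sum_ord (fun k => enorm (y k - xstar) ^+ 2)).
rewrite (telescope_sum_ord (fun k => (Lfac k)^-1)).
have -> : y 0%N = x 0%N by case: run.
(* The potential [1 / Lfac] stays between 0 and 1, so all errors together cost at most
   [r t ^+ 2 / 36]; doubling gives [1 / 18]. *)
have L0 : (Lfac 0)^-1 <= 1 by rewrite invf_le1.
have Lt : 0 <= (Lfac t.+1)^-1 by rewrite invr_ge0 ltW.
have := ler_wpM2l (_ : 0 <= r t ^+ 2 / 36) (_ : (Lfac 0)^-1 - (Lfac t.+1)^-1 <= 1).
rewrite divr_ge0 ?sqr_ge0 // => /(_ isT); lra.
Qed.

(** Both bounds advance together: [r t <= 4 d0] gives [d_{t+1}^2 <= (1 + 16/18) d0^2 < 4 d0^2], so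
    [y_{t+1}] is within [3 d0] of [x_0] and [x_{t+1}] within [3 d0 + 4 d0 / 12]. *)
Lemma stability t : (t <= T)%N -> enorm (y t - xstar) <= 2 * d0 /\ r t <= 4 * d0.
Proof.
have d0p := d0_gt0; have y0 : y 0%N = x 0%N by case: run.
elim: t => [|t IH] tT.
  rewrite y0; split; first by lra.
  apply: rbar_leP => [|k|k]; first by apply: le_trans reps_le _; lra.
    by rewrite leqn0 => /eqP ->; rewrite y0 subrr enorm0; lra.
  by rewrite leqn0 => /eqP ->; rewrite subrr enorm0; lra.
have [yt rt] := IH (ltnW tT).
have dy : enorm (y t.+1 - xstar) <= 2 * d0.
  rewrite -(@ler_pXn2r _ 2) ?nnegrE ?mulr_ge0 //.
  apply: le_trans (dist_sqr_le tT) _.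
  have : r t ^+ 2 <= (4 * d0) ^+ 2 by rewrite sqr_le ?mulr_ge0.
  by rewrite !exprMn; nra.
split => //; apply: rbarS_le => //.
  by have := enormB_le (y t.+1) xstar (x 0%N); rewrite (enormBC xstar); lra.
have := enormB_le (x t.+1) (y t) (x 0%N); have := enormB_le (y t) xstar (x 0%N).
by rewrite (enormBC xstar); have := x_step_le tT; lra.
Qed.

(** The factor [r t.+1], possibly far smaller than [d0], is kept because the lower bound on [S]
    comes in the same unit. Of the constant [5], four units come from the distances and one from the
    step errors. *)
Lemma gap_le t : (t < T)%N ->
  S t * gap t <= 5 * Dy t * r t.+1 * d0
                 - \sum_(k < t.+1) Dx k * enorm (y k - x k.+1) ^+ 2 / 2.
Proof.
move=> tT.
have tk k : (k <= t)%N -> (k < T)%N by move=> kt; apply: leq_ltn_trans tT.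
apply: le_trans (online_to_batch x y reps_gt0 xstar t grad_sub) _.
pose d2 k := enorm (y k - xstar) ^+ 2.
have : \sum_(k < t.+1) w k * dotv (g k) (x k.+1 - xstar) <=
   \sum_(k < t.+1) (Dy k * (d2 k - d2 k.+1) / 2
     + Dy t * (r t ^+ 2 / 36) * ((Lfac k)^-1 - (Lfac k.+1)^-1)
     - Dx k * enorm (y k - x k.+1) ^+ 2 / 2).
  apply: ler_sum => -[k /= kt] _; rewrite ltnS in kt.
  apply: le_trans (one_step (tk k kt)) _; rewrite lerD2r lerD2l.
  have := step_error_rel (tk k kt); rewrite ler_pdivrMr // => /le_trans; apply.
  rewrite mulrC -mulrA; apply: ler_pM; rewrite ?Dy_le //; first exact: ltW.
    rewrite mulr_ge0 ?sqr_ge0 // divr_ge0 // subr_ge0 lef_pV2 ?posrE // Lfac_le //.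
  rewrite [leRHS]mulrAC -mulrA; apply: ler_wpM2r.
    by rewrite divr_ge0 // subr_ge0 lef_pV2 ?posrE // Lfac_le.
  by rewrite sqr_le // rbar_le.
move=> /le_trans; apply.
rewrite big_split /= sumrN lerD2r big_split /= -mulr_suml -mulr_sumr.
rewrite (telescope_sum_ord (fun k => (Lfac k)^-1)).
have [dt rt] := stability tT; have [_ rt0] := stability (ltnW tT).
have rS : r t <= r t.+1 := rbar_leS reps x y t.
(* The difference of squares factors into a difference at most [2 r_{t+1}] and a sum at most
   [4 d0]. *)
have d2B k : (k <= t)%N -> d2 k <= d2 t.+1 + 8 * (r t.+1 * d0).
  move=> kt; have [dk _] := stability (ltnW (tk k kt)).
  have h1 := enormB_le (y k) (y t.+1) xstar.
  have h2 := enormB_le (y k) (x 0%N) (y t.+1); rewrite (enormBC (x 0%N)) in h2.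
  have h3 := enorm_y_le_rbar reps x y (leqW kt).
  have h4 := enorm_y_le_rbar reps x y (leqnn t.+1).
  have h5 : enorm (y k - xstar) - enorm (y t.+1 - xstar) <= 2 * r t.+1 by lra.
  have := norm_ge0 (y k - xstar); have := norm_ge0 (y t.+1 - xstar).
  by rewrite /d2; have := r_gt0 t.+1; have := d0_gt0; nra.
have := sum_mul_diff_le (ltW (Dy_gt0 0)) (fun k _ => Dy_leS k) d2B.
rewrite (addrC (d2 t.+1)) addrK => h1.
have h2 : (Lfac 0)^-1 - (Lfac t.+1)^-1 <= 1.
  have : 0 <= (Lfac t.+1)^-1 by rewrite invr_ge0 ltW.
  have : (Lfac 0)^-1 <= 1 by rewrite invf_le1.
  lra.
have h3 : r t ^+ 2 / 36 <= r t.+1 * d0 by have := r_gt0 t; nra.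
have h4 : r t ^+ 2 / 36 * ((Lfac 0)^-1 - (Lfac t.+1)^-1) <= r t.+1 * d0.
  by apply: le_trans h3; rewrite ler_piMr // divr_ge0 ?sqr_ge0.
have := ler_wpM2l (ltW (Dy_gt0 t)) h4; move: h1; lra.
Qed.


(** The ratio [rho] at [tau] bounds every [w_t / r_{t+1}], so the growth lemma gives
    [T <= (1 + rho) * logp (r T / r 0)]; then [w_tau = rho * r_{tau+1}] converts [rho] into
    [S tau]. *)
Lemma wgt_sum_ge tau : (tau < T)%N ->
  (forall t, (t < T)%N -> tau_ratio reps x y t <= tau_ratio reps x y tau) ->
  T%:R ^+ 2 * r tau.+1 <= 162 * logp (d0 / reps) ^+ 2 * S tau.
Proof.
move=> tT tau_max; set rho := tau_ratio reps x y tau; set l := logp _.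
have ratioE t : tau_ratio reps x y t = w t / r t.+1 by rewrite /tau_ratio wgtE.
have T0 : (0 < T)%N by apply: leq_trans tT.
(* At [t = 0] the ratio is [r 0 / r 1], and the radius grows by at most [7 / 6] per step. *)
have rho_ge : 6 / 7 <= rho.
  apply: le_trans (tau_max 0%N T0); rewrite ratioE wgtE // big_ord1 ler_pdivlMr //.
  by have := rbarS_ratio T0; lra.
have l1 : 1 <= l by rewrite logp_ge1 // ler_pdivlMr // mul1r.
have rho_gt0 : 0 < rho by lra.
have T_le : T%:R <= (1 + rho) * logp (r T / r 0%N).
  apply: (@index_le_ratio_log _ _ w) => // [k|k|k kT].
  - exact: rbar_leS.
  - exact: wgtE.
  - by have := tau_max k kT; rewrite -/rho ratioE ler_pdivrMr.
have l_le : logp (r T / r 0%N) <= 4 * l.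
  have : r T / r 0%N <= (1 + 3) * (d0 / reps).
    have [_ rT] := stability (leqnn T); have := rbar_ge_reps reps x y 0.
    rewrite ler_pdivrMr // => h; apply: le_trans rT _.
    have -> : (1 + 3) * (d0 / reps) * r 0%N = 4 * d0 * (r 0%N / reps).
      by field; rewrite gt_eqF.
    by rewrite ler_peMr ?mulr_ge0 // ler_pdivlMr // mul1r.
  move=> /ler_logp; rewrite divr_gt0 // => /(_ isT) /le_trans; apply.
  rewrite /logp lnM ?posrE ?divr_gt0 // ?addr_gt0 //.
  have := @le_ln1Dx R 3; rewrite (lt_trans (ltrN10 R)) // => /(_ isT).
  by move: l1; rewrite /l /logp; lra.
(* [4 (1 + rho) <= 9 rho] because [rho >= 6 / 7]; the final constant is [162 = 2 * 9^2]. *)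
have T_le9 : T%:R <= 9 * rho * l.
  by apply: le_trans T_le _; nra.
have sq : T%:R ^+ 2 <= (9 * rho * l) ^+ 2 by rewrite sqr_le ?ler0n //; nra.
have wE : w tau = rho * r tau.+1 by rewrite /rho ratioE divfK // gt_eqF.
have wS : rho ^+ 2 * r tau.+1 <= 2 * S tau.
  rewrite -(ler_pM2r (r_gt0 tau.+1)).
  have := sqr_wgt_le x y reps_gt0 tau; rewrite wE.
  by have := rbar_leS reps x y tau; have := S_gt0 tau; nra.
apply: le_trans (ler_wpM2r (r_ge0 _) sq) _.
have := ler_wpM2l (sqr_ge0 l) wS; lra.
Qed.

Lemma gap_le_of_regret tau (c : R) : (tau < T)%N ->
  (forall t, (t < T)%N -> tau_ratio reps x y t <= tau_ratio reps x y tau) ->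
  S tau * gap tau <= c * r tau.+1 ->
  gap tau <= 162 * logp (d0 / reps) ^+ 2 * (c / T%:R ^+ 2).
Proof.
move=> tT tau_max h; have T0 : 0 < T%:R :> R by rewrite ltr0n (leq_trans _ tT).
rewrite mulrA ler_pdivlMr ?exprn_gt0 // -(ler_pM2r (r_gt0 tau.+1)).
have g0 : 0 <= gap tau by rewrite subr_ge0.
have := ler_wpM2l g0 (wgt_sum_ge tT tau_max).
have l0 : 0 <= 162 * logp (d0 / reps) ^+ 2 by rewrite mulr_ge0 ?sqr_ge0.
have := ler_wpM2l l0 h; lra.
Qed.

Local Notation gap0 := (f (x 0%N) - f xstar).

(** Bounds [||m_0||] from below, which turns the ratio [Q / ||m_0||^2] in the logarithms into one
    involving the initial gap. *)
Lemma gap0_le : gap0 <= enorm (m 0%N) * d0.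
Proof.
rewrite mm0; exact: le_trans (sub_le_dotv_grad grad_sub _ _) (dotv_le _ _).
Qed.

Lemma Lfac_le_logp t (u : R) : 0 <= u ->
  Gsum t / enorm (m 0%N) ^+ 2 <= (1 + T%:R * u) ^+ 4 ->
  Lfac t <= 4 * logp (1 + T%:R * u).
Proof.
move=> u0 h; have Tu : 0 <= T%:R * u by rewrite mulr_ge0.
apply: le_trans (ler_logp _ h) _; first by rewrite divr_gt0 ?mm0_gt0.
rewrite /logp lnXn ?ltr_pwDl // mulr_natl; lra.
Qed.

(** * Regret when the gradient is Lipschitz *)

Section Smooth.
Variable b : R.
Hypothesis grad_lip : smooth_fun b grad.

Let b_gt0 : 0 < b := smooth_gt0 grad_sub xstar_min grad_lip grad0.
Let b_ge0 : 0 <= b := ltW b_gt0.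

(** The amplification [al t] is compensated by averaging:
    [al t * w t = w t ^+ 2 / r t <= 2 * S t]. *)
Lemma smooth_sqrt_qq t : al t * enorm (g t - m t) <= 2 * b * enorm (y t - x t.+1).
Proof.
apply: le_trans (ler_wpM2l (al_ge0 t) (grad_lip _ _)) _.
rewrite xbar_sub_zbar // enormZ (enormBC (x _)).
have ws0 : 0 <= w t / S t by rewrite divr_ge0 // ltW.
rewrite (ger0_norm ws0).
have h : al t * (w t / S t) <= 2.
  rewrite mulrA ler_pdivrMr // -(ler_pM2r (r_gt0 t)).
  by have := sqr_wgt_le x y reps_gt0 t; rewrite /wgt; lra.
have := ler_wpM2r (mulr_ge0 b_ge0 (norm_ge0 (y t - x t.+1))) h; lra.
Qed.

Lemma smooth_qq t : q t <= 4 * b ^+ 2 * enorm (y t - x t.+1) ^+ 2.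
Proof.
have h : (al t * enorm (g t - m t)) ^+ 2 <= (2 * b * enorm (y t - x t.+1)) ^+ 2.
  by apply: sqr_le (smooth_sqrt_qq t); rewrite mulr_ge0.
by move: h; rewrite /qq !exprMn; lra.
Qed.

Lemma smooth_qq_rbar t : (t < T)%N -> q t <= b ^+ 2 * r t ^+ 2 / 36.
Proof.
move=> tT; apply: le_trans (smooth_qq t) _.
have : enorm (y t - x t.+1) ^+ 2 <= (r t / 12) ^+ 2.
  by rewrite sqr_le // enormBC x_step_le.
by move=> /(ler_wpM2l (sqr_ge0 b)); rewrite expr_div_n; lra.
Qed.

Lemma smooth_mm0 : enorm (m 0%N) <= b * d0.
Proof.
have := grad_lip (x 0%N) xstar.
by rewrite (grad_min grad_sub xstar_min grad_lip) // subr0 mm0.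
Qed.

(** Splits [m_k] into [m_k - g_k], which enters through the summand [q_k] of [Q], and [g_k], whose
    squared norm is at most [4 b] times the gap at [xbar_k], bounded in turn by [gap_le]. *)
Lemma smooth_MM t : (t < T)%N -> M t <= 2 * Gsum t.+1 + 96 * b * d0 * Dy t.
Proof.
move=> tT.
have D0 : 0 <= b * d0 * Dy t by rewrite !mulr_ge0 // ltW.
apply: bigmax_le => [|[k /= kt] _].
  by have := Gsum_gt0 t.+1; lra.
rewrite ltnS in kt; have kT : (k < T)%N := leq_ltn_trans kt tT.
have mk : enorm (m k) ^+ 2 <= 2 * enorm (g k - m k) ^+ 2 + 2 * enorm (g k) ^+ 2.
  have := enormB_le (m k) (g k) 0; rewrite !subr0 (enormBC (m k)).
  move=> /(sqr_le (norm_ge0 _)).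
  by have := sqr_ge0 (enorm (g k - m k) - enorm (g k)); lra.
have qk : q k <= Gsum t.+1.
  by apply: le_trans (Gsum_le (_ : k.+1 <= t.+1)%N); rewrite // GsumS lerDr ltW.
have gk : al k ^+ 2 * enorm (g k) ^+ 2 <= 48 * (b * d0 * Dy t).
  have h1 := enorm_grad_sqr_le grad_sub xstar_min grad_lip (xbar reps x y k) b_gt0.
  have gk0 : 0 <= gap k by rewrite subr_ge0.
  have h2 := sqr_alpha_le x y reps_gt0 k.
  apply: le_trans (ler_pM (sqr_ge0 _) (sqr_ge0 _) h2 h1) _.
  have h3 : S k * gap k <= 6 * (Dy k * d0) * r k.
    have := gap_le kT.
    have : 0 <= \sum_(i < k.+1) Dx i * enorm (y i - x i.+1) ^+ 2 / 2.
      by apply: sumr_ge0 => i _; rewrite divr_ge0 // mulr_ge0 ?sqr_ge0 // ltW.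
    have Dd : 0 <= Dy k * d0 by rewrite mulr_ge0 // ltW.
    by have := ler_wpM2l Dd (rbarS_ratio kT); have := mulr_ge0 Dd (r_ge0 k); lra.
  have -> : 2 * S k / r k * (4 * b * gap k) = 8 * b * (S k * gap k / r k).
    by field; rewrite gt_eqF.
  have h4 : S k * gap k / r k <= 6 * (Dy t * d0).
    rewrite ler_pdivrMr //; apply: le_trans h3 _; rewrite ler_wpM2r // ler_pM2l //.
    by rewrite ler_wpM2r // Dy_le.
  by have := ler_wpM2l b_ge0 h4; lra.
by have := ler_wpM2l (sqr_ge0 (al k)) mk; move: qk; rewrite /qq; lra.
Qed.

(** [Dy t] contains the left side [N], so [smooth_MM] is self-bounding: [N^2 <= 2 a N + c N].
    Dividing by [N] gives the claim, with [1152 = 96 * 12]. *)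
Lemma smooth_scale_le t : (t < T)%N ->
  Num.sqrt (Num.max (Gsum t.+1) (M t))
    <= 2 * Num.sqrt (Gsum t.+1) + 1152 * (b * d0 * Lfac t.+1 ^+ 2).
Proof.
move=> tT; set N := Num.sqrt (Num.max _ _); set a := Num.sqrt _.
have N_gt0 : 0 < N by rewrite sqrtr_gt0 lt_max Gsum_gt0.
have a0 : 0 <= a by rewrite sqrtr_ge0.
have aN : a <= N by rewrite ler_wsqrtr // le_max lexx.
have a2 : a ^+ 2 = Gsum t.+1 by rewrite sqr_sqrtr // ltW.
rewrite -(ler_pM2r N_gt0) -expr2.
have -> : N ^+ 2 = Num.max (Gsum t.+1) (M t).
  by rewrite sqr_sqrtr // le_max ltW.
have bd : 0 <= b * d0 * Lfac t.+1 ^+ 2 * N.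
  apply: mulr_ge0 (ltW N_gt0); apply: mulr_ge0 (sqr_ge0 _); exact: mulr_ge0.
rewrite ge_max; apply/andP; split; first by rewrite -a2; nra.
apply: le_trans (smooth_MM tT) _; rewrite -a2 /Dy -/N; nra.
Qed.

(** The positive part of [gap_le] is linear in [sqrt Q] and the negative part quadratic, so
    completing the square removes [Q]. *)
Lemma smooth_regret t : (t < T)%N ->
  S t * gap t <= 300 ^+ 2 * (b * d0 ^+ 2 * Lfac t.+1 ^+ 4) * r t.+1.
Proof.
move=> tT; apply: le_trans (gap_le tT) _.
have [_ r4] := stability tT.
set N := Num.sqrt (Num.max (Gsum t.+1) (M t)).
set L := Lfac t.+1; set Q := Qprev grad reps x y t.+1.
have Q0 : 0 <= Q := Qprev_ge0 _.
have L1 : 1 <= L := Lfac_ge1 _.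
have N_le : N <= 2 * (b * d0 + Num.sqrt Q) + 1152 * (b * d0 * L ^+ 2).
  apply: le_trans (smooth_scale_le tT) _; rewrite lerD2r ler_pM2l //.
  have s0 : 0 <= b * d0 + Num.sqrt Q by rewrite addr_ge0 ?sqrtr_ge0 ?mulr_ge0.
  rewrite -[leRHS]ger0_norm // -sqrtr_sqr ler_wsqrtr // sqrrD sqr_sqrtr //.
  rewrite /Gsum -/Q lerD2r.
  have : enorm (m 0%N) ^+ 2 <= (b * d0) ^+ 2.
    by apply: sqr_le smooth_mm0.
  move=> /le_trans; apply; rewrite lerDl mulrn_wge0 // mulr_ge0 ?sqrtr_ge0 //.
  by rewrite mulr_ge0.
(* [Dx k >= 12 sqrt Q_{k-1}] and [smooth_qq] reduce the negative terms to the sum of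
   [sqrt Q_{k-1} q_k / b^2]; the threshold [b * r t.+1] brings out the factor [r t.+1] of the
   positive term. *)
have neg : r t.+1 * ((Q - 2 * (b * r t.+1) ^+ 2) / b)
    <= \sum_(k < t.+1) Dx k * enorm (y k - x k.+1) ^+ 2 / 2.
  have B0 : 0 <= (b * r t.+1) ^+ 2 by rewrite sqr_ge0.
  have qB k : (k < t.+1)%N -> q k <= (b * r t.+1) ^+ 2.
    move=> kt; have kT : (k < T)%N := leq_trans kt tT.
    apply: le_trans (smooth_qq_rbar kT) _; rewrite exprMn.
    have : r k ^+ 2 <= r t.+1 ^+ 2.
      by rewrite sqr_le // rbar_le // ltnW.
    move=> /(ler_wpM2l (sqr_ge0 b)).
    by have := mulr_ge0 (sqr_ge0 b) (sqr_ge0 (r k)); lra.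
  have := sum_sqrt_mul_ge (mulr_ge0 b_ge0 (r_ge0 t.+1)) B0 qq_ge0 qB.
  rewrite -[\sum_(i < t.+1) q i]/Q => h.
  have -> : r t.+1 * ((Q - 2 * (b * r t.+1) ^+ 2) / b) =
     (b ^+ 2)^-1 * (b * r t.+1 * (Q - (b * r t.+1) ^+ 2 - (b * r t.+1) ^+ 2)).
    by field; rewrite gt_eqF.
  apply: le_trans (ler_wpM2l _ h) _; first by rewrite invr_ge0 sqr_ge0.
  rewrite mulr_sumr; apply: ler_sum => k _.
  rewrite mulrC ler_pdivrMr ?exprn_gt0 //.
  have s0 := sqrtr_ge0 (Qprev grad reps x y k).
  have Ds : 12 * Num.sqrt (Qprev grad reps x y k) <= Dx k.
    by apply: Dx_ge; rewrite le_max lerDr sqr_ge0.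
  apply: le_trans (ler_wpM2l s0 (smooth_qq k)) _.
  have := ler_wpM2r (mulr_ge0 (sqr_ge0 b) (sqr_ge0 (enorm (y k - x k.+1)))) Ds.
  have := mulr_ge0 s0 (mulr_ge0 (sqr_ge0 b) (sqr_ge0 (enorm (y k - x k.+1)))).
  by rewrite /Qprev; lra.
apply: le_trans (lerB (lexx _) neg) _; rewrite /Dy -/N -/L.
have -> : 5 * (12 * L ^+ 2 * N) * r t.+1 * d0 - r t.+1 * ((Q - 2 * (b * r t.+1) ^+ 2) / b)
  = (60 * L ^+ 2 * d0 * N - (Q - 2 * (b * r t.+1) ^+ 2) / b) * r t.+1 by ring.
apply: ler_wpM2r => //; rewrite -(ler_pM2r b_gt0) mulrBl divfK ?gt_eqF //.
have L2 : 1 <= L ^+ 2 by rewrite exprn_ege1.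
have -> : L ^+ 4 = L ^+ 2 * L ^+ 2 by ring.
have sQ := sqr_sqrtr Q0; have := sqrtr_ge0 Q.
move: (Num.sqrt Q) (L ^+ 2) L2 sQ N_le => s l l1 <- N_le s0.
set e := b * d0 in N_le *.
have e0 : 0 <= e by rewrite mulr_ge0.
have el0 : 0 <= 60 * l * e by rewrite !mulr_ge0 //; lra.
have h1 := ler_wpM2l el0 N_le.
have h2 : (b * r t.+1) ^+ 2 <= 16 * e ^+ 2.
  have : (b * r t.+1) ^+ 2 <= (4 * e) ^+ 2.
    by apply: sqr_le; rewrite ?mulr_ge0 // /e mulrCA ler_pM2l.
  by rewrite exprMn; lra.
(* This square absorbs [120 l e s]; the total [120 + 69120 + 32 + 3600] stays below [300^2]. *)
have h3 := sqr_ge0 (60 * l * e - s).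
have ee := sqr_ge0 e.
have h4 : e ^+ 2 <= e ^+ 2 * (l * l) by rewrite ler_peMr // -[1]mulr1 ler_pM.
have h5 : e ^+ 2 * l <= e ^+ 2 * (l * l) by rewrite ler_wpM2l // ler_peMl //; lra.
have -> : 60 * l * d0 * N * b = 60 * l * e * N by rewrite /e; ring.
have -> : 300 ^+ 2 * (b * d0 ^+ 2 * (l * l)) * b = 300 ^+ 2 * (e ^+ 2 * (l * l)).
  by rewrite /e; ring.
move: h1 h3; lra.
Qed.

Lemma smooth_Lfac t : (t <= T)%N -> 0 < gap0 ->
  Lfac t <= 4 * logp (1 + T%:R * (b * d0 ^+ 2) / gap0).
Proof.
move=> tT gap_gt0; set u := b * d0 ^+ 2 / gap0.
have u0 : 0 <= u by rewrite divr_ge0 ?mulr_ge0 ?sqr_ge0 // ltW.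
rewrite -mulrA; apply: Lfac_le_logp => //.
have T0 : 0 <= T%:R :> R by [].
have m0 := mm0_gt0.
have Qt : Qprev grad reps x y t <= T%:R * (b * d0) ^+ 2.
  apply: (@le_trans _ _ (\sum_(k < t) (b * d0) ^+ 2)).
    apply: ler_sum => -[k /= kt] _; have kT := leq_trans kt tT.
    apply: le_trans (smooth_qq_rbar kT) _.
    have [_ rk] := stability (ltnW kT).
    have : r k ^+ 2 <= (4 * d0) ^+ 2 by rewrite sqr_le.
    move=> /(ler_wpM2l (sqr_ge0 b)).
    by have := mulr_ge0 (sqr_ge0 b) (sqr_ge0 d0); rewrite !exprMn; lra.
  by rewrite sumr_const card_ord -[leLHS]mulr_natl ler_wpM2r ?sqr_ge0 // ler_nat.
have mu : (b * d0) ^+ 2 <= u ^+ 2 * enorm (m 0%N) ^+ 2.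
  rewrite -exprMn sqr_le ?(mulr_ge0 b_ge0 (ltW d0_gt0)) //.
  have -> : u * enorm (m 0%N) = b * d0 * ((enorm (m 0%N) * d0) / gap0).
    by rewrite /u; field; rewrite gt_eqF.
  by rewrite ler_peMr ?mulr_ge0 // ler_pdivlMr // mul1r gap0_le.
rewrite ler_pdivrMr //.
(* [T <= T^2] for naturals, zero included, makes the left side at most [1 + (T u)^2]. *)
have h : 1 + T%:R * u ^+ 2 <= (1 + T%:R * u) ^+ 4.
  have T2 : T%:R <= T%:R ^+ 2 :> R.
    by rewrite -natrX ler_nat -mulnn; case: (T) => // k; rewrite leq_pmulr.
  have v0 : 0 <= T%:R * u by rewrite mulr_ge0.
  have := ler_wpM2r (sqr_ge0 u) T2; rewrite -exprMn.
  move: (T%:R * u) v0 => v v0 Tv.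
  have := exprn_ge0 2 v0; have := exprn_ge0 3 v0; have := exprn_ge0 4 v0; lra.
apply: le_trans (ler_wpM2r (ltW m0) h).
have := ler_wpM2l T0 mu; rewrite /Gsum; lra.
Qed.

End Smooth.

(** * Regret when the function is Lipschitz *)

Section Lipschitz.
Variable G : R.
Hypothesis f_lip : lipschitz_fun G f.

Let G_ge0 : 0 <= G.
Proof.
rewrite -(ler_pM2r d0_gt0) mul0r.
exact: le_trans (normr_ge0 _) (f_lip (x 0%N) xstar).
Qed.

Let gradG u : enorm (grad u) <= G := enorm_grad_le grad_sub u G_ge0 f_lip.

Let alpha_leT k : (k < T)%N -> al k <= T%:R.
Proof. by move=> kT; apply: le_trans (alpha_le x y reps_gt0 k) _; rewrite ler_nat. Qed.

Lemma lipschitz_qq k : (k < T)%N -> q k <= 4 * T%:R ^+ 2 * G ^+ 2.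
Proof.
move=> kT; have h : (al k * enorm (g k - m k)) ^+ 2 <= (T%:R * (2 * G)) ^+ 2.
  apply: sqr_le; first exact: mulr_ge0.
  apply: ler_pM => //; first exact: alpha_leT.
  apply: le_trans (enormB _ _) _.
  by have := lerD (gradG (xbar reps x y k)) (gradG (zbar reps x y k)); rewrite /gg /mm; lra.
by move: h; rewrite /qq !exprMn; lra.
Qed.

Lemma lipschitz_Qprev t : (t <= T)%N -> Qprev grad reps x y t <= 4 * T%:R ^+ 3 * G ^+ 2.
Proof.
move=> tT; apply: (@le_trans _ _ (\sum_(k < t) 4 * T%:R ^+ 2 * G ^+ 2)).
  by apply: ler_sum => -[k /= kt] _; apply: lipschitz_qq; exact: leq_trans tT.
rewrite sumr_const card_ord -[leLHS]mulr_natl.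
have -> : 4 * T%:R ^+ 3 * G ^+ 2 = T%:R * (4 * T%:R ^+ 2 * G ^+ 2) by ring.
by rewrite ler_wpM2r ?ler_nat // !mulr_ge0 ?sqr_ge0.
Qed.

(** The negative terms are discarded. With [al <= T] and gradients bounded by [G], the square root
    in [Dy] is of order [G T^(3/2)], so a later division by [T^2] leaves [1 / sqrt T]. *)
Lemma lipschitz_regret t : (t < T)%N ->
  S t * gap t <= 180 * (G * d0 * Lfac t.+1 ^+ 2) * (T%:R * Num.sqrt T%:R) * r t.+1.
Proof.
move=> tT; apply: le_trans (gap_le tT) _.
have T1 : 1 <= T%:R :> R by rewrite ler1n (leq_trans _ tT).
have T23 : T%:R ^+ 2 * G ^+ 2 <= T%:R ^+ 3 * G ^+ 2.
  by rewrite ler_wpM2r ?sqr_ge0 // ler_weXn2l.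
have T03 : G ^+ 2 <= T%:R ^+ 2 * G ^+ 2.
  by rewrite ler_peMl ?sqr_ge0 // exprn_ege1.
have N_le : Num.sqrt (Num.max (Gsum t.+1) (M t)) <= 3 * G * (T%:R * Num.sqrt T%:R).
  have e0 : 0 <= 3 * G * (T%:R * Num.sqrt T%:R) by rewrite !mulr_ge0 ?sqrtr_ge0.
  rewrite -[leRHS]ger0_norm // -sqrtr_sqr ler_wsqrtr //.
  have -> : (3 * G * (T%:R * Num.sqrt T%:R)) ^+ 2 = 9 * (T%:R ^+ 3 * G ^+ 2).
    by rewrite !exprMn sqr_sqrtr //; ring.
  have G20 := sqr_ge0 G.
  rewrite ge_max; apply/andP; split.
    have := lipschitz_Qprev tT.
    have : enorm (m 0%N) ^+ 2 <= G ^+ 2 by rewrite sqr_le // gradG.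
    by rewrite /Gsum; lra.
  apply: bigmax_le => [|[k /= kt] _]; first by lra.
  apply: (@le_trans _ _ (T%:R ^+ 2 * G ^+ 2)); last by lra.
  apply: ler_pM; rewrite ?sqr_ge0 // sqr_le //; last exact: gradG.
  by apply: alpha_leT; exact: leq_ltn_trans tT.
have neg : 0 <= \sum_(k < t.+1) Dx k * enorm (y k - x k.+1) ^+ 2 / 2.
  by apply: sumr_ge0 => i _; rewrite divr_ge0 // mulr_ge0 ?sqr_ge0 // ltW.
have c0 : 0 <= 60 * Lfac t.+1 ^+ 2 * (d0 * r t.+1).
  by apply: mulr_ge0; [apply: mulr_ge0 (sqr_ge0 _)|apply: mulr_ge0].
by have := ler_wpM2l c0 N_le; rewrite /Dy; lra.
Qed.

Lemma lipschitz_Lfac t : (t <= T)%N -> 0 < gap0 ->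
  Lfac t <= 4 * logp (1 + T%:R * (G * d0) / gap0).
Proof.
move=> tT gap_gt0; set u := G * d0 / gap0.
(* [u >= 1] is what allows [T^3 u^2 <= (T u)^3] below. *)
have u1 : 1 <= u.
  rewrite ler_pdivlMr // mul1r; apply: le_trans gap0_le _.
  by rewrite ler_wpM2r // gradG.
rewrite -mulrA; apply: Lfac_le_logp => //; first by apply: le_trans u1.
have m0 := mm0_gt0.
have mu : G ^+ 2 <= u ^+ 2 * enorm (m 0%N) ^+ 2.
  rewrite -exprMn sqr_le //.
  have -> : u * enorm (m 0%N) = G * ((enorm (m 0%N) * d0) / gap0).
    by rewrite /u; field; rewrite gt_eqF.
  by rewrite ler_peMr // ler_pdivlMr // mul1r gap0_le.
rewrite ler_pdivrMr //.
have T0 : 0 <= T%:R :> R by [].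
have h : 1 + 4 * T%:R ^+ 3 * u ^+ 2 <= (1 + T%:R * u) ^+ 4.
  have v0 : 0 <= T%:R * u by rewrite mulr_ge0 // (le_trans _ u1).
  have : T%:R ^+ 3 * u ^+ 2 <= (T%:R * u) ^+ 3.
    by rewrite [leRHS]exprMn; apply: ler_wpM2l; rewrite ?exprn_ge0 // ler_weXn2l.
  move: (T%:R * u) v0 => v v0 Tv.
  have := exprn_ge0 2 v0; have := exprn_ge0 3 v0; have := exprn_ge0 4 v0; lra.
apply: le_trans (ler_wpM2r (ltW m0) h).
have c0 : 0 <= 4 * T%:R ^+ 3 :> R by rewrite mulr_ge0 ?exprn_ge0.
have := lipschitz_Qprev tT; have := ler_wpM2l c0 mu; rewrite /Gsum; lra.
Qed.

End Lipschitz.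
End Run.

(** * Combination of the two cases with an absolute constant *)

Theorem theorem5 :
  exists C : nat,
  forall (R : realType) (n : nat) (f : 'rV[R]_n -> R) (grad : 'rV[R]_n -> 'rV[R]_n)
         (beta G : option R) (xstar : 'rV[R]_n) (reps : R) (T : nat)
         (x y : nat -> 'rV[R]_n),
    convex_fun f ->
    is_subgrad_oracle f grad ->
    (forall b, beta = Some b -> smooth_fun b grad) ->
    (forall g, G = Some g -> lipschitz_fun g f) ->
    (forall u, f xstar <= f u) ->
    0 < reps ->
    reps <= enorm (x 0%N - xstar) ->
    grad (x 0%N) != 0 ->
    udog_run grad reps x y T ->
    let d0 := enorm (x 0%N - xstar) in
    dbar y xstar T <= 2 * d0 /\
    rbar reps x y T <= 4 * d0 /\
    (forall tau : nat, (tau < T)%N ->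
       (forall t : nat, (t < T)%N ->
          tau_ratio reps x y t <= tau_ratio reps x y tau) ->
       f xstar < f (x 0%N) ->
       forall mA mB : R,
         omin (omap (fun b => b * d0 ^+ 2) beta) (omap (fun g => g * d0) G) = Some mA ->
         omin (omap (fun b => b * d0 ^+ 2 / (T%:R) ^+ 2) beta)
              (omap (fun g => g * d0 / Num.sqrt (T%:R)) G) = Some mB ->
         f (xbar reps x y tau) - f xstar
           <= C%:R * (logp (1 + T%:R * mA / (f (x 0%N) - f xstar)) ^+ 4
                      * logp (d0 / reps) ^+ 2) * mB).
Proof.
(* Covers [162 * 300^2 * 256 < 4 * 10^9] in the smooth case and [162 * 180 * 256] in the Lipschitz
   case, where [256 = 4^4]. *)
exists (10 ^ 10)%N => R n f grad beta G xstar reps T x y _ fg f_smooth f_lip xstar_min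
  reps0 reps_le g0 run d0.
have d0_gt0 : 0 < d0 := lt_le_trans reps0 reps_le.
have stab := stability fg xstar_min reps0 reps_le g0 run.
split.
  apply: bigmax_le => [|[k /= kT] _]; first by rewrite mulr_ge0 // ltW.
  by case: (stab k kT).
split; first by case: (stab T (leqnn T)).
move=> tau tauT tau_max gap_gt0 mA mB mAE mBE.
have D0 : 0 < f (x 0%N) - f xstar by rewrite subr_gt0.
have T0 : 0 < T%:R :> R by rewrite ltr0n (leq_trans _ tauT).
set L := Lfac grad reps x y tau.+1; set l := logp (d0 / reps).
set l' := logp _.
have bound := gap_le_of_regret fg xstar_min reps0 reps_le g0 run tauT tau_max.
have L1 : 1 <= L := Lfac_ge1 reps0 g0 run tau.+1.
have l20 : 0 <= l ^+ 2 by rewrite sqr_ge0.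
have beta_L b : beta = Some b -> L <= 4 * logp (1 + T%:R * (b * d0 ^+ 2) / (f (x 0%N) - f xstar)).
  by move=> /f_smooth bs; exact: (smooth_Lfac fg xstar_min reps0 reps_le g0 run bs tauT D0).
have G_L g : G = Some g -> L <= 4 * logp (1 + T%:R * (g * d0) / (f (x 0%N) - f xstar)).
  by move=> /f_lip bs; exact: (lipschitz_Lfac fg reps0 reps_le g0 run bs tauT D0).
(* The minima in [mA] and [mB] may be attained under different assumptions, so the logarithm and the
   gap are bounded separately. *)
have L_le : L <= 4 * l'.
  rewrite /l'; case: beta G mAE beta_L G_L {f_smooth f_lip mBE} => [b|] [g|] //= [<-] bL gL.
  - by case: (leP (b * d0 ^+ 2) (g * d0)) => _; [exact: bL|exact: gL].
  - exact: bL.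
  - exact: gL.
have L4 : L ^+ 4 <= 256 * l' ^+ 4.
  have : L ^+ 4 <= (4 * l') ^+ 4 by rewrite lerXn2r ?nnegrE //; lra.
  by rewrite exprMn; lra.
have beta_gap b : beta = Some b -> f (xbar reps x y tau) - f xstar
    <= (10 ^ 10)%N%:R * (l' ^+ 4 * l ^+ 2) * (b * d0 ^+ 2 / T%:R ^+ 2).
  move=> /f_smooth bs.
  have b0 := smooth_gt0 fg xstar_min bs g0.
  apply: le_trans (bound _ (smooth_regret fg xstar_min reps0 reps_le g0 run bs tauT)) _.
  rewrite -/L -/d0 -/l.
  have c0 : 0 <= b * d0 ^+ 2 / T%:R ^+ 2.
    by rewrite divr_ge0 ?sqr_ge0 // mulr_ge0 ?sqr_ge0 // ltW.
  have := ler_wpM2l (mulr_ge0 l20 c0) L4.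
  have := mulr_ge0 (mulr_ge0 l20 c0) (le_trans (exprn_ge0 4 (le_trans ler01 L1)) L4).
  rewrite natrX; lra.
have G_gap g : G = Some g -> f (xbar reps x y tau) - f xstar
    <= (10 ^ 10)%N%:R * (l' ^+ 4 * l ^+ 2) * (g * d0 / Num.sqrt T%:R).
  move=> /f_lip fl.
  have g_ge0 : 0 <= g.
    rewrite -(ler_pM2r d0_gt0) mul0r.
    exact: le_trans (normr_ge0 _) (fl (x 0%N) xstar).
  have := lipschitz_regret fg xstar_min reps0 reps_le g0 run fl tauT.
  move=> /bound /le_trans; apply; rewrite -/L -/d0 -/l.
  have sT : 0 < Num.sqrt T%:R :> R by rewrite sqrtr_gt0.
  have sT2 : T%:R = Num.sqrt T%:R * Num.sqrt T%:R :> R.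
    by rewrite -expr2 sqr_sqrtr // ltW.
  have -> : 180 * (g * d0 * L ^+ 2) * (T%:R * Num.sqrt T%:R) / T%:R ^+ 2
      = 180 * L ^+ 2 * (g * d0 / Num.sqrt T%:R).
    by move: (Num.sqrt _) sT sT2 => s s0 ->; field; rewrite gt_eqF.
  have c0 : 0 <= g * d0 / Num.sqrt T%:R.
    by rewrite divr_ge0 ?sqrtr_ge0 // mulr_ge0 // ltW.
  (* Only [L^2] occurs here; since [L >= 1] it is weakened to [L^4] to share the prefactor. *)
  have L24 : L ^+ 2 <= 256 * l' ^+ 4.
    by apply: le_trans L4; rewrite ler_weXn2l.
  have := ler_wpM2l (mulr_ge0 l20 c0) L24.
  have := mulr_ge0 (mulr_ge0 l20 c0) (le_trans (sqr_ge0 L) L24).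
  rewrite natrX; lra.
case: beta G mBE beta_gap G_gap {f_smooth f_lip mAE beta_L G_L} => [b|] [g|] //= [<-] bg gg.
- by case: (leP (b * d0 ^+ 2 / T%:R ^+ 2) (g * d0 / Num.sqrt T%:R)) => _; [exact: bg|exact: gg].
- exact: bg.
- exact: gg.
Qed.
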